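(* The tableaux algorithm obtained by adding the rule $SA(R_\Box,R_\Diamond,b)$ (from $bR_\Box y$ infer $yR_\Diamond b$) (resp. $SX(R_\Diamond,R_\Box,y)$: from $yR_\Diamond b$ infer $bR_\Box y$) to the LE-$\mathcal{ALC}$ tableaux expansion rules provides a polynomial-time sound and complete decision procedure for checking the consistency of $\mathcal{A}\cup\{\forall p\,(bR_\Box p \Rightarrow pR_\Diamond b)\}$ (resp. $\mathcal{A}\cup\{\forall p\,(yR_\Diamond p \Rightarrow pR_\Box y)\}$), for an LE-$\mathcal{ALC}$ ABox $\mathcal{A}$ and an object $b$ (resp. feature $y$) appearing in it.
   Context: LE-$\mathcal{ALC}$ is a two-sorted description logic over enriched formal contexts $(A,X,I,R_\Box,R_\Diamond)$, $I,R_\Box\subseteq A\times X$, $R_\Diamond\subseteq X\times A$. Concepts: $D \mid C_1\wedge C_2 \mid C_1\vee C_2 \mid \langle R_\Diamond\rangle C \mid [R_\Box]C$ (written $\Diamond C$, $\Box C$). ABox terms: $aR_\Box x$, $xR_\Diamond a$, $aIx$, $a:C$, $x::C$ and their negations; a clash is the presence of $\beta$ and $\neg\beta$ for a relational term $\beta$. The LE-$\mathcal{ALC}$ tableaux algorithm (non-branching; reports inconsistency iff a clash appears) uses the rules: creation (for each $C\in\mathcal{A}$ add $a_C:C$, $x_C::C$); basic ($b:C$, $y::C$ give $bIy$); $\wedge_A$, $\vee_X$ and their inverses (inverses only for meets/joins occurring in $\mathcal{A}$); $\Box$ ($b:[R_\Box]C$, $y::C$ give $bR_\Box y$); $\Diamond$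 ($y::\langle R_\Diamond\rangle C$, $b:C$ give $yR_\Diamond b$); adjunction ($bR_\Box y$ gives $\mathrm{L}_\Box b\,I\,y$ and $bI\Box y$; $yR_\Diamond b$ gives $\Diamond bIy$ and $bI\blacksquare y$, new individual names except $\Diamond a_C=a_{\Diamond C}$, $\Box x_C=x_{\Box C}$); $I$-compatibility ($bI\Box y$ or $\mathrm{L}_\Box b\,I\,y$ gives $bR_\Box y$; $bI\blacksquare y$ or $\Diamond bIy$ gives $yR_\Diamond b$); negative ($\neg(b:C)$ gives $\neg(bIx_C)$, $\neg(y::C)$ gives $\neg(a_CIy)$); appending ($bIx_C$ gives $b:C$, $a_CIy$ gives $y::C$). $\mathrm{L}_\Box$ is the left adjoint of $\Box$ (black lozenge in the paper), $\blacksquare$ the right adjoint of $\Diamond$. *)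

(* Defs.v *)
From HB Require Import structures.
From mathcomp Require Import all_boot.
From mathcomp Require Import boolp classical_sets.

Set Implicit Arguments.
Unset Strict Implicit.
Unset Printing Implicit Defensive.

Local Open Scope classical_set_scope.

Inductive concept (CN : Type) : Type :=
| Atom of CN
| Meet of concept CN & concept CN
| Join of concept CN & concept CN
| Dia of concept CN
| Box of concept CN.

(* O and F are the types of object names and of feature names.  They are
   parameters because an ABox given as input uses the individual names of the
   language only, whereas the tableau also uses the names that its rules
   generate. *)
Inductive term (CN O F : Type) : Type :=
| RBox of O & F               (* b R_Box y *)
| RDia of F & O               (* y R_Dia b *)
| Inc of O & F                (* b I y *)
| OIn of O & concept CN       (* b : C *)
| FIn of F & concept CN.      (* y :: C *)
Arguments RBox {CN O F}.
Arguments RDia {CN O F}.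
Arguments Inc {CN O F}.
Arguments OIn {CN O F}.
Arguments FIn {CN O F}.

Inductive assertion (CN O F : Type) : Type :=
| Pos of term CN O F
| Neg of term CN O F.
Arguments Pos {CN O F}.
Arguments Neg {CN O F}.

Notation abox CN O F := (seq (assertion CN O F)).

Definition concept_comparable (CN : eqType) : comparable (concept CN).
Proof. move=> C D; rewrite /decidable; decide equality; exact: eq_comparable. Defined.
HB.instance Definition _ (CN : eqType) :=
  hasDecEq.Build (concept CN) (compareP (@concept_comparable CN)).

Definition term_comparable (CN O F : eqType) : comparable (term CN O F).
Proof. move=> s t; rewrite /decidable; decide equality; exact: eq_comparable. Defined.
HB.instance Definition _ (CN O F : eqType) :=
  hasDecEq.Build (term CN O F) (compareP (@term_comparable CN O F)).

Definition assertion_comparable (CN O F : eqType) : comparable (assertion CN O F).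
Proof. move=> s t; rewrite /decidable; decide equality; exact: eq_comparable. Defined.
HB.instance Definition _ (CN O F : eqType) :=
  hasDecEq.Build (assertion CN O F) (compareP (@assertion_comparable CN O F)).

Definition relational (CN O F : Type) (t : term CN O F) : bool :=
  match t with RBox _ _ | RDia _ _ | Inc _ _ => true | _ => false end.

Definition body (CN O F : Type) (t : assertion CN O F) : term CN O F :=
  match t with Pos u | Neg u => u end.

Definition term_obj (CN O F : Type) (t : term CN O F) : seq O :=
  match t with
  | RBox b _ | RDia _ b | Inc b _ | OIn b _ => [:: b]
  | FIn _ _ => [::]
  end.

Definition term_feat (CN O F : Type) (t : term CN O F) : seq F :=
  match t with
  | RBox _ y | RDia y _ | Inc _ y | FIn y _ => [:: y]
  | OIn _ _ => [::]
  end.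

Definition obj_occurs (CN O F : eqType) (b : O) (A : abox CN O F) : bool :=
  has (fun t => b \in term_obj (body t)) A.

Definition feat_occurs (CN O F : eqType) (y : F) (A : abox CN O F) : bool :=
  has (fun t => y \in term_feat (body t)) A.

Fixpoint subconcepts (CN : Type) (C : concept CN) : seq (concept CN) :=
  C :: match C with
       | Atom _ => [::]
       | Meet C1 C2 | Join C1 C2 => subconcepts C1 ++ subconcepts C2
       | Dia C1 | Box C1 => subconcepts C1
       end.

Definition term_concepts (CN O F : Type) (t : term CN O F) : seq (concept CN) :=
  match t with
  | OIn _ C | FIn _ C => subconcepts C
  | _ => [::]
  end.

(* The concepts C with C "in" A: the subconcepts of the concepts of the
   (positive or negative) assertions of A. *)
Definition concepts (CN O F : Type) (A : abox CN O F) : seq (concept CN) :=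
  flatten [seq term_concepts (body t) | t <- A].

(* R^(1)[B] and R^(0)[Y]; with R the incidence relation these are the two maps
   of the Galois connection of a formal context. *)
Definition rel1 (U V : Type) (R : U -> V -> Prop) (B : set U) : set V :=
  [set v | forall u, B u -> R u v].
Definition rel0 (U V : Type) (R : U -> V -> Prop) (Y : set V) : set U :=
  [set u | forall v, Y v -> R u v].

Definition stable_obj (U V : Type) (I : U -> V -> Prop) (B : set U) : Prop :=
  rel0 I (rel1 I B) = B.
Definition stable_feat (U V : Type) (I : U -> V -> Prop) (Y : set V) : Prop :=
  rel1 I (rel0 I Y) = Y.

(* The four last fields are the I-compatibility of R_Box and R_Dia. *)
Record enriched_context : Type := EnrichedContext {
  obj : Type;
  feat : Type;
  inc : obj -> feat -> Prop;
  rbox : obj -> feat -> Prop;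
  rdia : feat -> obj -> Prop;
  rbox0_stable : forall x, stable_obj inc (rel0 rbox [set x]);
  rbox1_stable : forall a, stable_feat inc (rel1 rbox [set a]);
  rdia0_stable : forall a, stable_feat inc (rel0 rdia [set a]);
  rdia1_stable : forall x, stable_obj inc (rel1 rdia [set x])
}.

Record formal_concept (P : enriched_context) : Type := FormalConcept {
  extent : set (obj P);
  intent : set (feat P);
  extentK : rel1 (@inc P) extent = intent;
  intentK : rel0 (@inc P) intent = extent
}.

Section ComplexAlgebra.
Variable P : enriched_context.
Local Notation I := (@inc P).
Implicit Types (c d : formal_concept P).

Lemma sub_rel01 B : B `<=` rel0 I (rel1 I B).
Proof. by move=> a Ba x; apply. Qed.

Lemma sub_rel10 Y : Y `<=` rel1 I (rel0 I Y).
Proof. by move=> x Yx a; apply. Qed.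

Lemma rel0_rel10 Y : rel0 I (rel1 I (rel0 I Y)) = rel0 I Y.
Proof.
by apply/seteqP; split=> [a h x Yx|]; [apply: h; apply: sub_rel10|apply: sub_rel01].
Qed.

Lemma rel1_rel01 B : rel1 I (rel0 I (rel1 I B)) = rel1 I B.
Proof.
by apply/seteqP; split=> [x h a Ba|]; [apply: h; apply: sub_rel01|apply: sub_rel10].
Qed.

Lemma meet_stable c d : stable_obj I (extent c `&` extent d).
Proof.
apply/seteqP; split; last exact: sub_rel01.
by move=> a h; split; rewrite -intentK => x xc; apply: h => b [bc bd];
  [move: bc|move: bd]; rewrite -intentK; apply.
Qed.

Lemma join_stable c d : stable_feat I (intent c `&` intent d).
Proof.
apply/seteqP; split; last exact: sub_rel10.
by move=> x h; split; rewrite -extentK => a ac; apply: h => y [yc yd];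
  [move: yc|move: yd]; rewrite -extentK; apply.
Qed.

Lemma rbox_stable Y : stable_obj I (rel0 (@rbox P) Y).
Proof.
apply/seteqP; split; last exact: sub_rel01.
move=> a h x Yx; suff: rel0 (@rbox P) [set x] a by apply.
rewrite -rbox0_stable => z zx; apply: h => b hb; apply: zx.
by move=> _ ->; apply: hb.
Qed.

Lemma rdia_stable B : stable_feat I (rel0 (@rdia P) B).
Proof.
apply/seteqP; split; last exact: sub_rel10.
move=> x h a Ba; suff: rel0 (@rdia P) [set a] x by apply.
rewrite -rdia0_stable => b bx; apply: h => y hy; apply: bx.
by move=> _ ->; apply: hy.
Qed.

Definition fc_meet c d : formal_concept P := FormalConcept erefl (meet_stable c d).
Definition fc_join c d : formal_concept P := FormalConcept (join_stable c d) erefl.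
Definition fc_box c : formal_concept P :=
  FormalConcept erefl (rbox_stable (intent c)).
Definition fc_dia c : formal_concept P :=
  FormalConcept (rdia_stable (extent c)) erefl.

End ComplexAlgebra.

Record interpretation (CN ON FN : Type) : Type := Interpretation {
  ctx : enriched_context;
  iobj : ON -> obj ctx;
  ifeat : FN -> feat ctx;
  iatom : CN -> formal_concept ctx
}.

Fixpoint iconcept (CN ON FN : Type) (M : interpretation CN ON FN)
    (C : concept CN) : formal_concept (ctx M) :=
  match C with
  | Atom D => iatom M D
  | Meet C1 C2 => fc_meet (iconcept M C1) (iconcept M C2)
  | Join C1 C2 => fc_join (iconcept M C1) (iconcept M C2)
  | Dia C1 => fc_dia (iconcept M C1)
  | Box C1 => fc_box (iconcept M C1)
  end.

Definition sat_term (CN ON FN : Type) (M : interpretation CN ON FN)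
    (t : term CN ON FN) : Prop :=
  match t with
  | RBox a x => rbox (iobj M a) (ifeat M x)
  | RDia x a => rdia (ifeat M x) (iobj M a)
  | Inc a x => inc (iobj M a) (ifeat M x)
  | OIn a C => extent (iconcept M C) (iobj M a)
  | FIn x C => intent (iconcept M C) (ifeat M x)
  end.

Definition sat (CN ON FN : Type) (M : interpretation CN ON FN)
    (t : assertion CN ON FN) : Prop :=
  match t with
  | Pos u => sat_term M u
  | Neg u => ~ sat_term M u
  end.

Inductive separation (ON FN : Type) : Type :=
| SA of ON
| SX of FN.
Arguments SA {ON FN}.
Arguments SX {ON FN}.

(* forall p, b R_Box p => p R_Dia b, resp. forall p, y R_Dia p => p R_Box y;
   p ranges over all features, resp. objects, of the context. *)
Definition sat_separation (CN ON FN : Type) (M : interpretation CN ON FN)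
    (s : separation ON FN) : Prop :=
  match s with
  | SA b => forall p, rbox (iobj M b) p -> rdia p (iobj M b)
  | SX y => forall p, rdia (ifeat M y) p -> rbox p (ifeat M y)
  end.

Definition consistent (CN ON FN : eqType) (A : abox CN ON FN)
    (s : separation ON FN) : Prop :=
  exists M : interpretation CN ON FN,
    (forall t, t \in A -> sat M t) /\ sat_separation M s.

(* a_C is OCls C, x_C is FCls C; OLBox is the left adjoint of Box and FBlk the
   right adjoint of Dia.  Dia b and Box y are built with [odia] and [fbox],
   which identify Dia a_C with a_(Dia C) and Box x_C with x_(Box C); ODia
   (OCls C) and FBox (FCls C) are never generated. *)
Inductive oname (CN ON : Type) : Type :=
| ONam of ON
| OCls of concept CN
| ODia of oname CN ON
| OLBox of oname CN ON.
Arguments ONam {CN ON}.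
Arguments OCls {CN ON}.

Inductive fname (CN FN : Type) : Type :=
| FNam of FN
| FCls of concept CN
| FBox of fname CN FN
| FBlk of fname CN FN.
Arguments FNam {CN FN}.
Arguments FCls {CN FN}.

Definition oname_comparable (CN ON : eqType) : comparable (oname CN ON).
Proof. move=> a b; rewrite /decidable; decide equality; exact: eq_comparable. Defined.
HB.instance Definition _ (CN ON : eqType) :=
  hasDecEq.Build (oname CN ON) (compareP (@oname_comparable CN ON)).

Definition fname_comparable (CN FN : eqType) : comparable (fname CN FN).
Proof. move=> x y; rewrite /decidable; decide equality; exact: eq_comparable. Defined.
HB.instance Definition _ (CN FN : eqType) :=
  hasDecEq.Build (fname CN FN) (compareP (@fname_comparable CN FN)).

Definition odia (CN ON : Type) (b : oname CN ON) : oname CN ON :=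
  if b is OCls C then OCls (Dia C) else ODia b.

Definition fbox (CN FN : Type) (y : fname CN FN) : fname CN FN :=
  if y is FCls C then FCls (Box C) else FBox y.

Notation tabox CN ON FN := (abox CN (oname CN ON) (fname CN FN)).

Definition embed_term (CN ON FN : Type) (t : term CN ON FN) :
    term CN (oname CN ON) (fname CN FN) :=
  match t with
  | RBox a x => RBox (ONam a) (FNam x)
  | RDia x a => RDia (FNam x) (ONam a)
  | Inc a x => Inc (ONam a) (FNam x)
  | OIn a C => OIn (ONam a) C
  | FIn x C => FIn (FNam x) C
  end.

Definition embed (CN ON FN : Type) (A : abox CN ON FN) : tabox CN ON FN :=
  [seq match t with Pos u => Pos (embed_term u) | Neg u => Neg (embed_term u) end
  | t <- A].

Definition clash (CN O F : eqType) (A : abox CN O F) : Prop :=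
  exists t, [/\ relational t, Pos t \in A & Neg t \in A].

(* [rule s A new]: some instance of an expansion rule, with premises in A, has
   the conclusions new.  In the side conditions A is the current ABox. *)
Inductive rule (CN ON FN : eqType) (s : separation ON FN) (A : tabox CN ON FN) :
    tabox CN ON FN -> Prop :=
| rule_creation C : C \in concepts A ->
    rule s A [:: Pos (OIn (OCls C) C); Pos (FIn (FCls C) C)]
| rule_basic b y C : Pos (OIn b C) \in A -> Pos (FIn y C) \in A ->
    rule s A [:: Pos (Inc b y)]
| rule_meet b C1 C2 : Pos (OIn b (Meet C1 C2)) \in A ->
    rule s A [:: Pos (OIn b C1); Pos (OIn b C2)]
| rule_join y C1 C2 : Pos (FIn y (Join C1 C2)) \in A ->
    rule s A [:: Pos (FIn y C1); Pos (FIn y C2)]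
| rule_meet_inv b C1 C2 : Pos (OIn b C1) \in A -> Pos (OIn b C2) \in A ->
    Meet C1 C2 \in concepts A ->
    rule s A [:: Pos (OIn b (Meet C1 C2))]
| rule_join_inv y C1 C2 : Pos (FIn y C1) \in A -> Pos (FIn y C2) \in A ->
    Join C1 C2 \in concepts A ->
    rule s A [:: Pos (FIn y (Join C1 C2))]
| rule_box b y C : Pos (OIn b (Box C)) \in A -> Pos (FIn y C) \in A ->
    rule s A [:: Pos (RBox b y)]
| rule_dia b y C : Pos (FIn y (Dia C)) \in A -> Pos (OIn b C) \in A ->
    rule s A [:: Pos (RDia y b)]
| rule_adj_box b y : Pos (RBox b y) \in A ->
    rule s A [:: Pos (Inc (OLBox b) y); Pos (Inc b (fbox y))]
| rule_adj_dia b y : Pos (RDia y b) \in A ->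
    rule s A [:: Pos (Inc (odia b) y); Pos (Inc b (FBlk y))]
| rule_comp_fbox b y : Pos (Inc b (fbox y)) \in A ->
    rule s A [:: Pos (RBox b y)]
| rule_comp_lbox b y : Pos (Inc (OLBox b) y) \in A ->
    rule s A [:: Pos (RBox b y)]
| rule_comp_blk b y : Pos (Inc b (FBlk y)) \in A ->
    rule s A [:: Pos (RDia y b)]
| rule_comp_odia b y : Pos (Inc (odia b) y) \in A ->
    rule s A [:: Pos (RDia y b)]
| rule_neg_obj b C : Neg (OIn b C) \in A ->
    rule s A [:: Neg (Inc b (FCls C))]
| rule_neg_feat y C : Neg (FIn y C) \in A ->
    rule s A [:: Neg (Inc (OCls C) y)]
| rule_app_obj b C : Pos (Inc b (FCls C)) \in A ->
    rule s A [:: Pos (OIn b C)]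
| rule_app_feat y C : Pos (Inc (OCls C) y) \in A ->
    rule s A [:: Pos (FIn y C)]
| rule_SA b y : s = SA b -> Pos (RBox (ONam b) y) \in A ->
    rule s A [:: Pos (RDia y (ONam b))]
| rule_SX y b : s = SX y -> Pos (RDia (FNam y) b) \in A ->
    rule s A [:: Pos (RBox b (FNam y))].

Definition applicable (CN ON FN : eqType) (s : separation ON FN)
    (A new : tabox CN ON FN) : Prop :=
  rule s A new /\ has (fun t => t \notin A) new.

(* Sizes count symbols; an individual name or atomic concept name of the
   language is one symbol. *)
Fixpoint csize (CN : Type) (C : concept CN) : nat :=
  match C with
  | Atom _ => 1
  | Meet C1 C2 | Join C1 C2 => (csize C1 + csize C2).+1
  | Dia C1 | Box C1 => (csize C1).+1
  end.

Fixpoint osize (CN ON : Type) (b : oname CN ON) : nat :=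
  match b with
  | ONam _ => 1
  | OCls C => (csize C).+1
  | ODia b1 | OLBox b1 => (osize b1).+1
  end.

Fixpoint fsize (CN FN : Type) (y : fname CN FN) : nat :=
  match y with
  | FNam _ => 1
  | FCls C => (csize C).+1
  | FBox y1 | FBlk y1 => (fsize y1).+1
  end.

Definition tsize (CN ON FN : Type)
    (t : assertion CN (oname CN ON) (fname CN FN)) : nat :=
  (match body t with
   | RBox b y | RDia y b | Inc b y => osize b + fsize y
   | OIn b C => osize b + csize C
   | FIn y C => fsize y + csize C
   end).+2.

Definition asize (CN ON FN : Type) (A : tabox CN ON FN) : nat :=
  sumn [seq tsize t | t <- A].

(* A timed value carries the number of elementary operations spent on it:
   comparing two expressions costs the sum of their sizes, writing an
   expression costs its size, and visiting an element of a list costs 1. *)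
Definition timed (T : Type) : Type := (T * nat)%type.

Definition ret (T : Type) (x : T) : timed T := (x, 0).

Definition bind (T U : Type) (m : timed T) (f : T -> timed U) : timed U :=
  ((f m.1).1, m.2 + (f m.1).2).

Definition compare (T : eqType) (sz : T -> nat) (x y : T) : timed bool :=
  (x == y, sz x + sz y).

Fixpoint search_has (T : Type) (p : T -> timed bool) (r : seq T) : timed bool :=
  if r is x :: r' then
    bind (p x) (fun ok : bool =>
      if ok then (true, 1) else bind (search_has p r') (fun v => (v, 1)))
  else ret false.

Definition search_mem (T : eqType) (sz : T -> nat) (x : T) : seq T -> timed bool :=
  search_has (compare sz x).

Fixpoint collect (T U : Type) (f : T -> timed (seq U)) (r : seq T) : timed (seq U) :=
  if r is x :: r' then
    bind (f x) (fun u => bind (collect f r') (fun v => (u ++ v, (size u).+1)))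
  else ret [::].

Section Program.
Variables (CN ON FN : eqType) (s : separation ON FN).
Local Notation assert := (assertion CN (oname CN ON) (fname CN FN)).
Local Notation taboxes := (seq (tabox CN ON FN)).

Definition emit (new : tabox CN ON FN) : timed taboxes := ([:: new], asize new).

Definition guard (ok : timed bool) (new : tabox CN ON FN) : timed taboxes :=
  bind ok (fun v : bool => if v then emit new else ret [::]).

Definition both (m1 m2 : timed taboxes) : timed taboxes :=
  bind m1 (fun u => bind m2 (fun v => (u ++ v, (size u).+1))).

Definition odia_inv (b : oname CN ON) : option (oname CN ON) :=
  match b with
  | OCls (Dia C) => Some (OCls C)
  | ODia (OCls _) => None
  | ODia b1 => Some b1
  | _ => None
  end.

Definition fbox_inv (y : fname CN FN) : option (fname CN FN) :=
  match y with
  | FCls (Box C) => Some (FCls C)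
  | FBox (FCls _) => None
  | FBox y1 => Some y1
  | _ => None
  end.

Definition obj_instances (b : oname CN ON) (y : fname CN FN) : timed taboxes :=
  both (if odia_inv b is Some b1 then emit [:: Pos (RDia y b1)] else ret [::])
    match b with
    | OLBox b1 => emit [:: Pos (RBox b1 y)]
    | OCls C => emit [:: Pos (FIn y C)]
    | _ => ret [::]
    end.

Definition feat_instances (b : oname CN ON) (y : fname CN FN) : timed taboxes :=
  both (if fbox_inv y is Some y1 then emit [:: Pos (RBox b y1)] else ret [::])
    match y with
    | FBlk y1 => emit [:: Pos (RDia y1 b)]
    | FCls C => emit [:: Pos (OIn b C)]
    | _ => ret [::]
    end.

Definition instances1 (t : assert) : timed taboxes :=
  match t with
  | Pos (OIn b (Meet C1 C2)) => emit [:: Pos (OIn b C1); Pos (OIn b C2)]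
  | Pos (FIn y (Join C1 C2)) => emit [:: Pos (FIn y C1); Pos (FIn y C2)]
  | Pos (RBox b y) =>
      both (emit [:: Pos (Inc (OLBox b) y); Pos (Inc b (fbox y))])
        (if s is SA b0 then
           guard (compare (@osize CN ON) b (ONam b0)) [:: Pos (RDia y b)]
         else ret [::])
  | Pos (RDia y b) =>
      both (emit [:: Pos (Inc (odia b) y); Pos (Inc b (FBlk y))])
        (if s is SX y0 then
           guard (compare (@fsize CN FN) y (FNam y0)) [:: Pos (RBox b y)]
         else ret [::])
  | Pos (Inc b y) => both (obj_instances b y) (feat_instances b y)
  | Neg (OIn b C) => emit [:: Neg (Inc b (FCls C))]
  | Neg (FIn y C) => emit [:: Neg (Inc (OCls C) y)]
  | _ => ret [::]
  end.

(* cs lists the concepts occurring in the current ABox. *)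
Definition instances2 (cs : seq (concept CN)) (t u : assert) : timed taboxes :=
  match t, u with
  | Pos (OIn b C), Pos (FIn y D) =>
      both (guard (compare (@csize CN) C D) [:: Pos (Inc b y)])
        (both
          (if C is Box C1 then
             guard (compare (@csize CN) C1 D) [:: Pos (RBox b y)]
           else ret [::])
          (if D is Dia D1 then
             guard (compare (@csize CN) C D1) [:: Pos (RDia y b)]
           else ret [::]))
  | Pos (OIn b C1), Pos (OIn b' C2) =>
      bind (compare (@osize CN ON) b b') (fun same : bool =>
        if same then
          guard (search_mem (@csize CN) (Meet C1 C2) cs) [:: Pos (OIn b (Meet C1 C2))]
        else ret [::])
  | Pos (FIn y C1), Pos (FIn y' C2) =>
      bind (compare (@fsize CN FN) y y') (fun same : bool =>
        if same then
          guard (search_mem (@csize CN) (Join C1 C2) cs) [:: Pos (FIn y (Join C1 C2))]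
        else ret [::])
  | _, _ => ret [::]
  end.

Definition list_concepts (A : tabox CN ON FN) : timed (seq (concept CN)) :=
  (concepts A, asize A).

Definition instances (A : tabox CN ON FN) : timed taboxes :=
  bind (list_concepts A) (fun cs =>
    both (collect (fun C => emit [:: Pos (OIn (OCls C) C); Pos (FIn (FCls C) C)]) cs)
      (both (collect instances1 A)
            (collect (fun t => collect (instances2 cs t) A) A))).

Definition is_new (A new : tabox CN ON FN) : timed bool :=
  search_has (fun t => bind (search_mem (@tsize CN ON FN) t A)
                            (fun v => ret (~~ v))) new.

Definition find_applicable (A : tabox CN ON FN) : timed taboxes :=
  bind (instances A) (collect (fun new => bind (is_new A new) (fun v : bool =>
    ret (if v then [:: new] else [::])))).

Definition find_clash (A : tabox CN ON FN) : timed bool :=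
  search_has (fun t => match t with
    | Neg u => if relational u then search_mem (@tsize CN ON FN) (Pos u) A
               else ret false
    | Pos _ => ret false
    end) A.

(* One round of the algorithm on A: look for a clash, list the applicable
   instances of the rules, and add the conclusions of one of them (these have
   been written by find_applicable). *)
Definition round_time (A : tabox CN ON FN) : nat :=
  ((find_clash A).2 + (find_applicable A).2).+1.

End Program.

Section ProgramCorrectness.
Variables (CN ON FN : eqType) (s : separation ON FN).
Implicit Types (A new : tabox CN ON FN).

Lemma search_hasE (T : Type) (p : T -> timed bool) r :
  (search_has p r).1 = has (fun x => (p x).1) r.
Proof. by elim: r => //= x r <-; case: (p x) => [[] n]. Qed.

Lemma search_memE (T : eqType) (sz : T -> nat) x r :
  (search_mem sz x r).1 = (x \in r).
Proof. by rewrite search_hasE -has_pred1; apply: eq_has => y; rewrite /= eq_sym. Qed.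

Lemma mem_collect (T U : eqType) (f : T -> timed (seq U)) r u :
  reflect (exists2 x, x \in r & u \in (f x).1) (u \in (collect f r).1).
Proof.
elim: r => [|x r IH] /=; first by constructor; case.
rewrite mem_cat; apply: (iffP orP) => [[ux|/IH[z zr uz]]|[z]].
- by exists x; rewrite ?mem_head.
- by exists z; rewrite // in_cons zr orbT.
by rewrite in_cons => /predU1P[->|zr] uz; [left|right; apply/IH; exists z].
Qed.

Lemma mem_both (m1 m2 : timed (seq (tabox CN ON FN))) new :
  (new \in (both m1 m2).1) = (new \in m1.1) || (new \in m2.1).
Proof. by rewrite /= mem_cat. Qed.

Lemma mem_guard ok (n new : tabox CN ON FN) :
  (new \in (guard ok n).1) = ok.1 && (new == n).
Proof. by case: ok => [[] k]; rewrite /= ?inE. Qed.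

Lemma find_clashP A : reflect (clash A) (find_clash A).1.
Proof.
rewrite search_hasE; apply: (iffP hasP) => [[[u|u] uA] //=|[t [rt pt nt]]].
  by case: ifP => // ru; rewrite search_memE => pu; exists u.
by exists (Neg t) => //=; rewrite rt search_memE.
Qed.

Lemma odia_invP (b b1 : oname CN ON) : odia_inv b = Some b1 <-> b = odia b1.
Proof.
split; last by move->; case: b1.
by case: b => [a|[]|[]|] //= => [C [<-]|a [<-]|b [<-]|b [<-]].
Qed.

Lemma fbox_invP (y y1 : fname CN FN) : fbox_inv y = Some y1 <-> y = fbox y1.
Proof.
split; last by move->; case: y1.
by case: y => [a|[]|[]|] //= => [C [<-]|a [<-]|b [<-]|b [<-]].
Qed.

Lemma mem_instances A new : new \in (instances s A).1 <-> rule s A new.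
Proof.
rewrite /instances.
change (new \in (both (collect (fun C => emit
  [:: Pos (OIn (OCls C) C); Pos (FIn (FCls C) C)]) (concepts A))
  (both (collect (instances1 s) A)
     (collect (fun t => collect (instances2 (concepts A) t) A) A))).1
  <-> rule s A new).
rewrite !mem_both; split=> [/or3P[]|].
- by move=> /mem_collect[C CA]; rewrite inE => /eqP->; constructor.
- move=> /mem_collect[t tA].
  case: t tA => [] [b y|y b|b y|b C|y C] tA; rewrite /instances1 ?mem_both //.
  + rewrite inE => /predU1P[->|]; first exact: rule_adj_box.
    case E: s => [b0|//]; rewrite mem_guard => /andP[/eqP eb /eqP->].
    by rewrite eb in tA *; apply: rule_SA tA.
  + rewrite inE => /predU1P[->|]; first exact: rule_adj_dia.
    case E: s => [//|y0]; rewrite mem_guard => /andP[/eqP ey /eqP->].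
    by rewrite ey in tA *; apply: rule_SX tA.
  + rewrite /obj_instances /feat_instances ?mem_both.
    case/orP=> /orP[].
    * case E: odia_inv => [b1|//]; rewrite inE => /eqP->.
      by move/odia_invP: E tA => ->; apply: rule_comp_odia.
    * by case: b tA => // [C|b1] tA; rewrite inE => /eqP->;
        [apply: rule_app_feat|apply: rule_comp_lbox].
    * case E: fbox_inv => [y1|//]; rewrite inE => /eqP->.
      by move/fbox_invP: E tA => ->; apply: rule_comp_fbox.
    * by case: y tA => // [C|y1] tA; rewrite inE => /eqP->;
        [apply: rule_app_obj|apply: rule_comp_blk].
  + by case: C tA => // C1 C2 tA; rewrite inE => /eqP->; apply: rule_meet.
  + by case: C tA => // C1 C2 tA; rewrite inE => /eqP->; apply: rule_join.
  + by rewrite inE => /eqP->; apply: rule_neg_obj.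
  + by rewrite inE => /eqP->; apply: rule_neg_feat.
- move=> /mem_collect[t tA] /mem_collect[u uA].
  case: t tA => [] // [] // b C tA; case: u uA => [] // [] // y D uA.
  + rewrite /=; case: eqP => //= eb; rewrite -/(guard _ _) mem_guard search_memE.
    by case/andP=> CD /eqP->; apply: rule_meet_inv => //; rewrite eb.
  + rewrite /instances2 !mem_both mem_guard => /or3P[/andP[/eqP/= e /eqP->]| |].
    * by apply: (@rule_basic _ _ _ _ _ _ _ C) => //; rewrite e.
    * case: C tA => // C tA; rewrite mem_guard => /andP[/eqP/= e /eqP->].
      by apply: (@rule_box _ _ _ _ _ _ _ C) => //; rewrite e.
    * case: D uA => // D uA; rewrite mem_guard => /andP[/eqP/= e /eqP->].
      by apply: (@rule_dia _ _ _ _ _ _ _ D) => //; rewrite -e.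
  + rewrite /=; case: eqP => //= ey; rewrite -/(guard _ _) mem_guard search_memE.
    by case/andP=> CD /eqP->; apply: rule_join_inv => //; rewrite ey.
have one t : t \in A -> new \in (instances1 s t).1 ->
    [|| new \in (collect (fun C => emit
      [:: Pos (OIn (OCls C) C); Pos (FIn (FCls C) C)]) (concepts A)).1,
      new \in (collect (instances1 s) A).1
    | new \in (collect (fun t => collect (instances2 (concepts A) t) A) A).1].
  by move=> tA h; apply/or3P/Or32/mem_collect; exists t.
have two t u : t \in A -> u \in A -> new \in (instances2 (concepts A) t u).1 ->
    [|| new \in (collect (fun C => emit
      [:: Pos (OIn (OCls C) C); Pos (FIn (FCls C) C)]) (concepts A)).1,
      new \in (collect (instances1 s) A).1
    | new \in (collect (fun t => collect (instances2 (concepts A) t) A) A).1].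
  by move=> tA uA h; apply/or3P/Or33/mem_collect; exists t => //; apply/mem_collect; exists u.
move=> h; case: h one two => {new} /=.
- move=> C CA _ _; apply/or3P/Or31/mem_collect; exists C => //=; exact: mem_head.
- move=> b y C bA yA _; apply; [exact: bA|exact: yA|].
  by rewrite /instances2 !mem_both mem_guard /= !eqxx.
- by move=> b C1 C2 h + _; apply; [exact: h|exact: mem_head].
- by move=> b C1 C2 h + _; apply; [exact: h|exact: mem_head].
- move=> b C1 C2 h1 h2 hc _; apply; [exact: h1|exact: h2|].
  by rewrite /= eqxx -/(guard _ _) mem_guard search_memE hc eqxx.
- move=> b C1 C2 h1 h2 hc _; apply; [exact: h1|exact: h2|].
  by rewrite /= eqxx -/(guard _ _) mem_guard search_memE hc eqxx.
- move=> b y C bA yA _; apply; [exact: bA|exact: yA|].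
  by rewrite /instances2 !mem_both !mem_guard /= !eqxx orbT.
- move=> b y C yA bA _; apply; [exact: bA|exact: yA|].
  by rewrite /instances2 !mem_both !mem_guard /= !eqxx ?orbT.
- by move=> b y h + _; apply; [exact: h|rewrite /instances1 mem_both /= ?mem_cat !inE !eqxx].
- by move=> b y h + _; apply; [exact: h|rewrite /instances1 mem_both /= ?mem_cat !inE !eqxx].
- move=> b y h + _; apply; [exact: h|].
  rewrite /instances1 /obj_instances /feat_instances !mem_both.
  by have/fbox_invP-> := erefl (fbox y); rewrite /= ?mem_cat !inE !eqxx ?orbT.
- move=> b y h + _; apply; [exact: h|].
  by rewrite /instances1 /obj_instances /feat_instances !mem_both /= ?mem_cat !inE !eqxx ?orbT.
- move=> b y h + _; apply; [exact: h|].
  by rewrite /instances1 /obj_instances /feat_instances !mem_both /= ?mem_cat !inE !eqxx ?orbT.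
- move=> b y h + _; apply; [exact: h|].
  rewrite /instances1 /obj_instances /feat_instances !mem_both.
  by have/odia_invP-> := erefl (odia b); rewrite /= !inE !eqxx.
- by move=> b C h + _; apply; [exact: h|exact: mem_head].
- by move=> b C h + _; apply; [exact: h|exact: mem_head].
- move=> b C h + _; apply; [exact: h|].
  by rewrite /instances1 /obj_instances /feat_instances !mem_both /= ?mem_cat !inE !eqxx ?orbT.
- move=> b C h + _; apply; [exact: h|].
  by rewrite /instances1 /obj_instances /feat_instances !mem_both /= ?mem_cat !inE !eqxx ?orbT.
- move=> b y -> h + _; apply; [exact: h|].
  by rewrite /instances1 mem_both mem_guard /= !eqxx ?orbT.
- move=> b y -> h + _; apply; [exact: h|].
  by rewrite /instances1 mem_both mem_guard /= !eqxx ?orbT.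
Qed.

Lemma find_applicableP A new :
  new \in (find_applicable s A).1 <-> applicable s A new.
Proof.
have newE n : (is_new A n).1 = has (fun t => t \notin A) n.
  by rewrite search_hasE; apply: eq_has => t; rewrite /= search_memE.
rewrite /find_applicable; split=> [/mem_collect[n /mem_instances rn]|[rn nn]].
  by rewrite /= newE; case: ifP => // nn; rewrite inE => /eqP->.
by apply/mem_collect; exists new; [apply/mem_instances|rewrite /= newE nn mem_head].
Qed.

End ProgramCorrectness.

(* [reaches s A B t]: starting from A, the algorithm may arrive at B after time
   t; the choice of the applicable instance is arbitrary in each round. *)
Inductive reaches (CN ON FN : eqType) (s : separation ON FN)
    (A : tabox CN ON FN) : tabox CN ON FN -> nat -> Prop :=
| reaches_start : reaches s A A 0
| reaches_round B t new :
    reaches s A B t -> ~ clash B -> applicable s B new ->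
    reaches s A (new ++ B) (t + round_time s B).

Definition halted (CN ON FN : eqType) (s : separation ON FN)
    (B : tabox CN ON FN) : Prop :=
  clash B \/ forall new, ~ applicable s B new.

Definition abox_size (CN ON FN : Type) (A : abox CN ON FN) : nat :=
  asize (embed A).

(* The tableau algorithm with the rule s, started on A, always stops within
   time T (the last round included) and reports a clash exactly when A together
   with the formula of s has no model. *)
Definition decides_within (CN ON FN : eqType) (s : separation ON FN)
    (A : abox CN ON FN) (T : nat) : Prop :=
  [/\ forall B t, reaches s (embed A) B t -> t + round_time s B <= T,
      exists B t, reaches s (embed A) B t /\ halted s B &
      forall B t, reaches s (embed A) B t -> halted s B ->
        (clash B <-> ~ consistent A s)].

(* Main.v *)
(* A clash refutes consistency because every rule is sound in any lattice with
   operators Box and Dia that have adjoints, when names are read as elements of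
   the lattice; the concept lattice of a model is such an algebra.  Conversely, a
   saturated clash-free ABox is its own model: the objects and features are all
   the names, and the three relations are membership in the ABox.

   The same soundness argument, in other algebras, bounds the tableau. In a
   chain of six elements an object name whose operators do not follow the
   pattern [LBox] Dia^i LBox^j [e] (one optional operator at each end) evaluates
   to the top, so it is below no feature; in the chain of integers with Box =
   pred and Dia = succ, the depth of the names is bounded. A Kripke frame on
   modal words shows that a concept created by the adjunction rules is a concept
   of the input preceded by a word read on one of the branches of the input
   concepts. So only polynomially many assertions can occur, and each round adds
   a new one. *)

From Stdlib Require Import ZArith Lia.
From mathcomp Require Import all_boot zify.
From mathcomp Require Import boolp classical_sets.
Require Import Defs.

Set Implicit Arguments.
Unset Strict Implicit.
Unset Printing Implicit Defensive.

Lemma forall_seq1 (T : eqType) (P : T -> Prop) a :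
  {in [:: a], forall x, P x} <-> P a.
Proof. by split=> [|Pa x]; [apply; rewrite mem_head | rewrite mem_seq1 => /eqP->]. Qed.

Lemma forall_seq2 (T : eqType) (P : T -> Prop) a b :
  {in [:: a; b], forall x, P x} <-> P a /\ P b.
Proof.
split=> [/forall_cons[Pa /forall_seq1] //|[Pa Pb]].
by apply/forall_cons; split; last exact/forall_seq1.
Qed.

(* Unlike the algorithm, a derivation may go on after a clash; this covers the
   instances that a round lists without applying them. *)
Inductive derivation (CN ON FN : eqType) (s : separation ON FN)
    (A : tabox CN ON FN) : tabox CN ON FN -> Prop :=
| derivation_start : derivation s A A
| derivation_rule B new : derivation s A B -> rule s B new -> derivation s A (new ++ B).

Lemma reaches_derivation (CN ON FN : eqType) (s : separation ON FN)
    (A B : tabox CN ON FN) n : reaches s A B n -> derivation s A B.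
Proof.
by elim=> [|{n}{}B n new _ AB _ [r _]]; [apply: derivation_start|apply: derivation_rule].
Qed.

Lemma derivation_sub (CN ON FN : eqType) (s : separation ON FN)
    (A B : tabox CN ON FN) : derivation s A B -> {subset A <= B}.
Proof. by elim=> // {}B new _ AB _ u /AB uB; rewrite mem_cat uB orbT. Qed.

(** * Algebraic semantics of the expansion rules *)

Record modal_algebra : Type := ModalAlgebra {
  carrier :> Type;
  mle : carrier -> carrier -> Prop;
  mmeet : carrier -> carrier -> carrier;
  mjoin : carrier -> carrier -> carrier;
  mbox : carrier -> carrier;
  mdia : carrier -> carrier;
  mlbox : carrier -> carrier;
  mblk : carrier -> carrier;
  mle_refl : forall x, mle x x;
  mle_trans : forall y x z, mle x y -> mle y z -> mle x z;
  mle_meet : forall x y z, mle z (mmeet x y) <-> mle z x /\ mle z y;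
  mjoin_le : forall x y z, mle (mjoin x y) z <-> mle x z /\ mle y z;
  mlbox_adj : forall x y, mle (mlbox x) y <-> mle x (mbox y);
  mdia_adj : forall x y, mle (mdia x) y <-> mle x (mblk y)
}.

Definition opposite (L : modal_algebra) : modal_algebra :=
  @ModalAlgebra L (fun x y => mle y x) (@mjoin L) (@mmeet L)
    (@mdia L) (@mbox L) (@mblk L) (@mlbox L) (@mle_refl L)
    (fun y x z yx zy => mle_trans zy yx)
    (@mjoin_le L) (@mle_meet L)
    (fun x y => iff_sym (mdia_adj y x)) (fun x y => iff_sym (mlbox_adj y x)).

Section Monotonicity.
Variable L : modal_algebra.
Implicit Types x y : L.

Lemma mlbox_homo x y : mle x y -> mle (mlbox x) (mlbox y).
Proof. by move=> xy; apply/mlbox_adj/(mle_trans xy)/mlbox_adj/mle_refl. Qed.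

Lemma mdia_homo x y : mle x y -> mle (mdia x) (mdia y).
Proof. by move=> xy; apply/mdia_adj/(mle_trans xy)/mdia_adj/mle_refl. Qed.

End Monotonicity.

Lemma mblk_homo (L : modal_algebra) (x y : L) : mle x y -> mle (mblk x) (mblk y).
Proof. exact: (@mlbox_homo (opposite L)). Qed.

Lemma mbox_homo (L : modal_algebra) (x y : L) : mle x y -> mle (mbox x) (mbox y).
Proof. exact: (@mdia_homo (opposite L)). Qed.

Definition signed (CN O F : Type) (P N : term CN O F -> Prop)
    (u : assertion CN O F) : Prop :=
  match u with Pos t => P t | Neg t => N t end.

Section Evaluation.
Variables (CN ON FN : eqType) (L : modal_algebra).
Variables (obj_val : ON -> L) (feat_val : FN -> L) (atom_val : CN -> L).
Implicit Types (b : oname CN ON) (y : fname CN FN) (C : concept CN).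
Local Notation trm := (term CN (oname CN ON) (fname CN FN)).

Fixpoint concept_value C : L :=
  match C with
  | Atom D => atom_val D
  | Meet C1 C2 => mmeet (concept_value C1) (concept_value C2)
  | Join C1 C2 => mjoin (concept_value C1) (concept_value C2)
  | Dia C1 => mdia (concept_value C1)
  | Box C1 => mbox (concept_value C1)
  end.

Fixpoint obj_value b : L :=
  match b with
  | ONam a => obj_val a
  | OCls C => concept_value C
  | ODia b1 => mdia (obj_value b1)
  | OLBox b1 => mlbox (obj_value b1)
  end.

Fixpoint feat_value y : L :=
  match y with
  | FNam x => feat_val x
  | FCls C => concept_value C
  | FBox y1 => mbox (feat_value y1)
  | FBlk y1 => mblk (feat_value y1)
  end.

Definition holds (t : trm) : Prop :=
  match t with
  | RBox b y => mle (obj_value b) (mbox (feat_value y))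
  | RDia y b => mle (mdia (obj_value b)) (feat_value y)
  | Inc b y => mle (obj_value b) (feat_value y)
  | OIn b C => mle (obj_value b) (concept_value C)
  | FIn y C => mle (concept_value C) (feat_value y)
  end.

Definition separates (s : separation ON FN) : Prop :=
  match s with
  | SA b => forall p, mle (obj_val b) (mbox p) -> mle (mdia (obj_val b)) p
  | SX y => forall p, mle (mdia p) (feat_val y) -> mle p (mbox (feat_val y))
  end.

Lemma obj_value_odia b : obj_value (odia b) = mdia (obj_value b).
Proof. by case: b. Qed.

Lemma feat_value_fbox y : feat_value (fbox y) = mbox (feat_value y).
Proof. by case: y. Qed.

Section Soundness.
Variables (s : separation ON FN) (N : trm -> Prop).
Hypothesis separated : separates s.
Hypothesis N_obj : forall b C, N (OIn b C) -> N (Inc b (FCls C)).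
Hypothesis N_feat : forall y C, N (FIn y C) -> N (Inc (OCls C) y).

Lemma rule_sound (B new : tabox CN ON FN) :
  {in B, forall u, signed holds N u} -> rule s B new ->
  {in new, forall u, signed holds N u}.
Proof.
move=> valid; case.
- by move=> C _; apply/forall_seq2; split; apply: mle_refl.
- by move=> b y C /valid/= bC /valid/= Cy; apply/forall_seq1; apply: mle_trans bC Cy.
- by move=> b C1 C2 /valid/= /mle_meet ?; apply/forall_seq2.
- by move=> y C1 C2 /valid/= /mjoin_le ?; apply/forall_seq2.
- by move=> b C1 C2 /valid/= ? /valid/= ? _; apply/forall_seq1/mle_meet.
- by move=> y C1 C2 /valid/= ? /valid/= ? _; apply/forall_seq1/mjoin_le.
- move=> b y C /valid/= bC /valid/= Cy; apply/forall_seq1.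
  exact: mle_trans bC (mbox_homo Cy).
- move=> b y C /valid/= Cy /valid/= bC; apply/forall_seq1.
  exact: mle_trans (mdia_homo bC) Cy.
- move=> b y /valid/= ?; apply/forall_seq2.
  by rewrite /= feat_value_fbox; split=> //; apply/mlbox_adj.
- move=> b y /valid/= ?; apply/forall_seq2.
  by rewrite /= obj_value_odia; split=> //; apply/mdia_adj.
- by move=> b y /valid/=; rewrite feat_value_fbox => ?; apply/forall_seq1.
- by move=> b y /valid/= /mlbox_adj ?; apply/forall_seq1.
- by move=> b y /valid/= /mdia_adj ?; apply/forall_seq1.
- by move=> b y /valid/=; rewrite obj_value_odia => ?; apply/forall_seq1.
- by move=> b C /valid/= ?; apply/forall_seq1; apply: N_obj.
- by move=> y C /valid/= ?; apply/forall_seq1; apply: N_feat.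
- by move=> b C /valid/= ?; apply/forall_seq1.
- by move=> y C /valid/= ?; apply/forall_seq1.
- move=> b y def_s /valid/= ?; apply/forall_seq1.
  by move: separated; rewrite def_s; apply.
- move=> y b def_s /valid/= ?; apply/forall_seq1.
  by move: separated; rewrite def_s; apply.
Qed.

Lemma derivation_sound (A B : tabox CN ON FN) :
  {in A, forall u, signed holds N u} -> derivation s A B ->
  {in B, forall u, signed holds N u}.
Proof.
move=> validA; elim=> {B} // B new _ validB r u.
by rewrite mem_cat => /orP[|/validB //]; apply: rule_sound r u.
Qed.

End Soundness.

End Evaluation.

(** * A clash refutes consistency *)

Section ConceptLattice.
Variable P : enriched_context.
Local Notation I := (@inc P).
Implicit Types (c d e : formal_concept P).
Local Open Scope classical_set_scope.

Definition fc_le c d : Prop := extent c `<=` extent d.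

Lemma fc_le_intent c d : fc_le c d <-> intent d `<=` intent c.
Proof.
split=> sub; first by rewrite -(extentK c) => x dx a /sub; rewrite -(intentK d); apply.
by rewrite /fc_le -(intentK d) => a ca x /sub; rewrite -(extentK c); apply.
Qed.

Lemma fc_le_meet c d e : fc_le e (fc_meet c d) <-> fc_le e c /\ fc_le e d.
Proof. by rewrite /fc_le subsetI. Qed.

Lemma fc_join_le c d e : fc_le (fc_join c d) e <-> fc_le c e /\ fc_le d e.
Proof. by rewrite !fc_le_intent subsetI. Qed.

Lemma rbox_set_stable B : stable_feat I (rel1 (@rbox P) B).
Proof.
apply/seteqP; split; last exact: sub_rel10.
move=> x xB a Ba; suff: rel1 (@rbox P) [set a] x by apply.
rewrite -rbox1_stable => b ab; apply: xB => y By; apply: ab => _ ->; exact: By.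
Qed.

Lemma rdia_set_stable Y : stable_obj I (rel1 (@rdia P) Y).
Proof.
apply/seteqP; split; last exact: sub_rel01.
move=> a aY x Yx; suff: rel1 (@rdia P) [set x] a by apply.
rewrite -rdia1_stable => y xy; apply: aY => b Yb; apply: xy => _ ->; exact: Yb.
Qed.

Definition fc_lbox c : formal_concept P :=
  FormalConcept (rbox_set_stable (extent c)) erefl.
Definition fc_blk c : formal_concept P :=
  FormalConcept erefl (rdia_set_stable (intent c)).

Lemma fc_lbox_adj c d : fc_le (fc_lbox c) d <-> fc_le c (fc_box d).
Proof. by rewrite fc_le_intent; split=> le u cu v dv; apply: le. Qed.

Lemma fc_dia_adj c d : fc_le (fc_dia c) d <-> fc_le c (fc_blk d).
Proof. by rewrite fc_le_intent; split=> le u cu v dv; apply: le. Qed.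

Definition fc_algebra : modal_algebra :=
  @ModalAlgebra (formal_concept P) fc_le _ _ _ _ _ _
    (fun c => @subset_refl _ (extent c))
    (fun d c e => @subset_trans _ (extent d) (extent c) (extent e))
    fc_le_meet fc_join_le fc_lbox_adj fc_dia_adj.

Definition fc_obj (a : obj P) : formal_concept P :=
  @FormalConcept P (rel0 I (rel1 I [set a])) (rel1 I [set a]) (rel1_rel01 _) erefl.
Definition fc_feat (x : feat P) : formal_concept P :=
  @FormalConcept P (rel0 I [set x]) (rel1 I (rel0 I [set x])) erefl (rel0_rel10 _).

Lemma fc_obj_le a c : fc_le (fc_obj a) c <-> extent c a.
Proof.
split=> [|ca]; first by apply; apply: sub_rel01.
by apply/fc_le_intent; rewrite -(extentK c) => x cx _ ->; apply: cx.
Qed.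

Lemma fc_le_feat c x : fc_le c (fc_feat x) <-> intent c x.
Proof.
split=> [/fc_le_intent|cx]; first by apply; apply: sub_rel10.
by rewrite /fc_le -(intentK c) => a ca _ ->; apply: ca.
Qed.

Lemma fc_obj_le_feat a x : fc_le (fc_obj a) (fc_feat x) <-> I a x.
Proof.
split=> [/fc_obj_le|ax]; first by apply.
by apply/fc_obj_le => _ ->.
Qed.

Lemma fc_obj_le_box a x : fc_le (fc_obj a) (fc_box (fc_feat x)) <-> rbox a x.
Proof.
split=> [/fc_obj_le|ax]; first by apply; apply: sub_rel10.
apply/fc_obj_le => y xy; suff: rel1 (@rbox P) [set a] y by apply.
by rewrite -rbox1_stable => b ab; apply: xy => _ ->; apply: ab => _ ->.
Qed.

Lemma fc_dia_le_feat a x : fc_le (fc_dia (fc_obj a)) (fc_feat x) <-> rdia x a.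
Proof.
split=> [/fc_le_feat|xa]; first by apply; apply: sub_rel01.
apply/fc_le_feat => b ab; suff: rel1 (@rdia P) [set x] b by apply.
by rewrite -rdia1_stable => y xy; apply: ab => _ ->; apply: xy => _ ->.
Qed.

End ConceptLattice.

Section ModelAlgebra.
Variables (CN ON FN : eqType) (M : interpretation CN ON FN).

Definition holds_in_model : term CN (oname CN ON) (fname CN FN) -> Prop :=
  @holds CN ON FN (fc_algebra (ctx M)) (fun a => fc_obj (iobj M a))
    (fun x => fc_feat (ifeat M x)) (@iatom CN ON FN M).

Lemma concept_value_iconcept C :
  concept_value (L := fc_algebra (ctx M)) (@iatom CN ON FN M) C = iconcept M C.
Proof. by elim: C => //= [C -> D ->|C -> D ->|C ->|C ->]. Qed.

Lemma holds_in_model_embed t : holds_in_model (embed_term t) <-> sat_term M t.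
Proof.
case: t => [a x|x a|a x|a C|x C]; rewrite /holds_in_model /= ?concept_value_iconcept.
- exact: fc_obj_le_box.
- exact: fc_dia_le_feat.
- exact: fc_obj_le_feat.
- exact: fc_obj_le.
- exact: fc_le_feat.
Qed.

Lemma sat_separation_separates s :
  sat_separation M s ->
  separates (L := fc_algebra (ctx M)) (fun a => fc_obj (iobj M a))
    (fun x => fc_feat (ifeat M x)) s.
Proof.
case: s => [b|y] /= sep p.
- move=> /fc_obj_le bp; apply/fc_le_intent => x px.
  by apply/fc_le_feat/fc_dia_le_feat/sep/bp.
- by move=> /fc_le_feat yp a pa; apply/fc_obj_le/fc_obj_le_box/sep/yp.
Qed.

End ModelAlgebra.

Lemma clash_inconsistent (CN ON FN : eqType) (s : separation ON FN)
    (A : abox CN ON FN) B :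
  derivation s (embed A) B -> clash B -> ~ consistent A s.
Proof.
move=> AB [t [_ tB ntB]] [M [satA sepM]].
pose valid := holds_in_model M.
have validA : {in embed A, forall u, signed valid (fun t => ~ valid t) u}.
  by move=> _ /mapP[[v|v] /satA satv ->] /=; rewrite /valid holds_in_model_embed.
have validB := derivation_sound (N := fun t => ~ valid t) (sat_separation_separates sepM)
  (fun _ _ => id) (fun _ _ => id) validA AB.
exact: validB ntB (validB _ tB).
Qed.

(** * Subconcepts *)

Definition subconcept_closed (CN : Type) (P : concept CN -> Prop) : Prop :=
  forall C, P C -> match C with
    | Atom _ => True
    | Meet C1 C2 | Join C1 C2 => P C1 /\ P C2
    | Dia C1 | Box C1 => P C1
    end.

Lemma subconcepts_refl (CN : eqType) (C : concept CN) : C \in subconcepts C.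
Proof. by case: C => *; rewrite mem_head. Qed.

Lemma subconcept_closed_trans (CN : eqType) (P : concept CN -> Prop) C :
  subconcept_closed P -> P C -> {in subconcepts C, forall D, P D}.
Proof.
move=> closed PC D; elim: C PC => [N|C IHC E IHE|C IHC E IHE|C IHC|C IHC] PC;
  rewrite /= in_cons => /predU1P[-> //|] //; have := closed _ PC; rewrite ?mem_cat.
- by case=> /IHC ihC /IHE ihE /orP[].
- by case=> /IHC ihC /IHE ihE /orP[].
- exact: IHC.
- exact: IHC.
Qed.

Lemma subconcepts_trans (CN : eqType) (C D : concept CN) :
  D \in subconcepts C -> {subset subconcepts D <= subconcepts C}.
Proof.
elim: C => [N|C IHC C' IHC'|C IHC C' IHC'|C IHC|C IHC] /=;
  rewrite in_cons => /predU1P[-> //|] // DC E ED; rewrite inE; apply/orP; right.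
- by move: DC; rewrite !mem_cat => /orP[/IHC->|/IHC'->]; rewrite ?orbT.
- by move: DC; rewrite !mem_cat => /orP[/IHC->|/IHC'->]; rewrite ?orbT.
- exact: IHC ED.
- exact: IHC ED.
Qed.

Lemma concepts_closed (CN O F : eqType) (A : abox CN O F) :
  subconcept_closed [in concepts A].
Proof.
move=> C /flatten_mapP[t tA tC].
have sub D : D \in subconcepts C -> D \in concepts A.
  move=> CD; apply/flatten_mapP; exists t => //.
  by case: (body t) tC => //= _ E CE; apply: subconcepts_trans CD.
by case: C sub {tC} => [N|C D|C D|C|C] sub //; try split; apply: sub;
  rewrite /= inE ?mem_cat subconcepts_refl ?orbT.
Qed.

Lemma mem_concepts (CN O F : eqType) (A : abox CN O F) u :
  u \in A -> {subset term_concepts (body u) <= concepts A}.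
Proof. by move=> uA C uC; apply/flatten_mapP; exists u. Qed.

(** * The canonical model of a saturated clash-free ABox *)

Section PolarStability.
Variables (U V : Type) (R : U -> V -> Prop).
Local Open Scope classical_set_scope.

Lemma rel0_stable Y : stable_obj R (rel0 R Y).
Proof. by apply/seteqP; split=> [u uY v Yv|u uY v]; [apply: uY => w; apply|apply]. Qed.

Lemma rel1_stable W : stable_feat R (rel1 R W).
Proof. by apply/seteqP; split=> [v vW u Wu|v vW u]; [apply: vW => w; apply|apply]. Qed.

End PolarStability.

Section CanonicalModel.
Variables (CN ON FN : eqType) (s : separation ON FN) (B : tabox CN ON FN).
Hypothesis saturated : forall new, rule s B new -> {subset new <= B}.
Local Open Scope classical_set_scope.

Definition canon_inc (b : oname CN ON) (y : fname CN FN) : Prop := Pos (Inc b y) \in B.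
Definition canon_rbox (b : oname CN ON) (y : fname CN FN) : Prop := Pos (RBox b y) \in B.
Definition canon_rdia (y : fname CN FN) (b : oname CN ON) : Prop := Pos (RDia y b) \in B.

Lemma saturated1 u : rule s B [:: u] -> u \in B.
Proof. by move=> /saturated; apply; rewrite mem_head. Qed.

Lemma saturated2 u v : rule s B [:: u; v] -> u \in B /\ v \in B.
Proof. by move=> /saturated sub; split; apply: sub; rewrite !inE eqxx ?orbT. Qed.

Lemma canon_rbox_fbox b y : canon_rbox b y <-> canon_inc b (fbox y).
Proof.
by split=> [/(rule_adj_box s)/saturated2[]|/(rule_comp_fbox s)/saturated1].
Qed.

Lemma canon_rbox_lbox b y : canon_rbox b y <-> canon_inc (OLBox b) y.
Proof.
by split=> [/(rule_adj_box s)/saturated2[]|/(rule_comp_lbox s)/saturated1].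
Qed.

Lemma canon_rdia_blk b y : canon_rdia y b <-> canon_inc b (FBlk y).
Proof.
by split=> [/(rule_adj_dia s)/saturated2[]|/(rule_comp_blk s)/saturated1].
Qed.

Lemma canon_rdia_odia b y : canon_rdia y b <-> canon_inc (odia b) y.
Proof.
by split=> [/(rule_adj_dia s)/saturated2[]|/(rule_comp_odia s)/saturated1].
Qed.

Lemma canon_rbox0_stable y : stable_obj canon_inc (rel0 canon_rbox [set y]).
Proof.
suff -> : rel0 canon_rbox [set y] = rel0 canon_inc [set fbox y] by apply: rel0_stable.
by apply/seteqP; split=> b by_ _ ->; apply/canon_rbox_fbox; apply: by_.
Qed.

Lemma canon_rbox1_stable b : stable_feat canon_inc (rel1 canon_rbox [set b]).
Proof.
suff -> : rel1 canon_rbox [set b] = rel1 canon_inc [set OLBox b] by apply: rel1_stable.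
by apply/seteqP; split=> y by_ _ ->; apply/canon_rbox_lbox; apply: by_.
Qed.

Lemma canon_rdia0_stable b : stable_feat canon_inc (rel0 canon_rdia [set b]).
Proof.
suff -> : rel0 canon_rdia [set b] = rel1 canon_inc [set odia b] by apply: rel1_stable.
by apply/seteqP; split=> y yb _ ->; apply/canon_rdia_odia; apply: yb.
Qed.

Lemma canon_rdia1_stable y : stable_obj canon_inc (rel1 canon_rdia [set y]).
Proof.
suff -> : rel1 canon_rdia [set y] = rel0 canon_inc [set FBlk y] by apply: rel0_stable.
by apply/seteqP; split=> b yb _ ->; apply/canon_rdia_blk; apply: yb.
Qed.

Definition canon_ctx : enriched_context :=
  EnrichedContext canon_rbox0_stable canon_rbox1_stable
    canon_rdia0_stable canon_rdia1_stable.

Definition canon_atom (D : CN) : formal_concept canon_ctx :=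
  @FormalConcept canon_ctx (rel0 canon_inc [set FCls (Atom D)]) _
    erefl (rel0_stable canon_inc [set FCls (Atom D)]).

Definition canon_model : interpretation CN ON FN :=
  @Interpretation CN ON FN canon_ctx (@ONam CN ON) (@FNam CN FN) canon_atom.

Definition extent_listed (C : concept CN) : Prop :=
  forall b, extent (iconcept canon_model C) b <-> Pos (OIn b C) \in B.

Definition intent_listed (C : concept CN) : Prop :=
  forall y, intent (iconcept canon_model C) y <-> Pos (FIn y C) \in B.

Section Membership.
Variable C : concept CN.
Hypothesis CB : C \in concepts B.

Lemma cls_obj_listed : Pos (OIn (OCls C) C) \in B.
Proof. by have [] := saturated2 (rule_creation s CB). Qed.

Lemma cls_feat_listed : Pos (FIn (FCls C) C) \in B.
Proof. by have [] := saturated2 (rule_creation s CB). Qed.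

Lemma obj_in_canon_inc b : Pos (OIn b C) \in B <-> canon_inc b (FCls C).
Proof.
split=> [bC|/(rule_app_obj s)/saturated1 //].
exact/saturated1/(rule_basic s bC)/cls_feat_listed.
Qed.

Lemma feat_in_canon_inc y : Pos (FIn y C) \in B <-> canon_inc (OCls C) y.
Proof.
split=> [yC|/(rule_app_feat s)/saturated1 //].
exact/saturated1/(rule_basic s cls_obj_listed)/yC.
Qed.

Lemma intent_listed_of_extent : extent_listed C -> intent_listed C.
Proof.
move=> extC y; rewrite -extentK; split=> [Cy|yC b /extC bC].
  by apply/feat_in_canon_inc/Cy/extC/cls_obj_listed.
exact: saturated1 (rule_basic s bC yC).
Qed.

Lemma extent_listed_of_intent : intent_listed C -> extent_listed C.
Proof.
move=> intC b; rewrite -intentK; split=> [Cb|bC y /intC yC].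
  by apply/obj_in_canon_inc/Cb/intC/cls_feat_listed.
exact: saturated1 (rule_basic s bC yC).
Qed.

End Membership.

Lemma meet_extent_listed C D : Meet C D \in concepts B ->
  extent_listed C -> extent_listed D -> extent_listed (Meet C D).
Proof.
move=> CDB extC extD b; split=> [[/extC bC /extD bD]|].
  exact: saturated1 (rule_meet_inv s bC bD CDB).
by move=> /(rule_meet s)/saturated2[/extC ? /extD ?].
Qed.

Lemma join_intent_listed C D : Join C D \in concepts B ->
  intent_listed C -> intent_listed D -> intent_listed (Join C D).
Proof.
move=> CDB intC intD y; split=> [[/intC yC /intD yD]|].
  exact: saturated1 (rule_join_inv s yC yD CDB).
by move=> /(rule_join s)/saturated2[/intC ? /intD ?].
Qed.

Lemma dia_intent_listed C : C \in concepts B -> Dia C \in concepts B ->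
  extent_listed C -> intent_listed (Dia C).
Proof.
move=> CB DCB extC y; split=> [yC|yC b /extC bC]; last first.
  exact: saturated1 (rule_dia s yC bC).
exact/(feat_in_canon_inc DCB)/(canon_rdia_odia (OCls C))/yC/extC/cls_obj_listed.
Qed.

Lemma box_extent_listed C : C \in concepts B -> Box C \in concepts B ->
  intent_listed C -> extent_listed (Box C).
Proof.
move=> CB BCB intC b; split=> [bC|bC y /intC yC]; last first.
  exact: saturated1 (rule_box s bC yC).
exact/(obj_in_canon_inc BCB)/(canon_rbox_fbox _ (FCls C))/bC/intC/cls_feat_listed.
Qed.

Lemma canon_model_listed C : C \in concepts B -> extent_listed C /\ intent_listed C.
Proof.
have of_ext D : D \in concepts B -> extent_listed D -> extent_listed D /\ intent_listed D.
  by move=> DB extD; split=> //; apply: intent_listed_of_extent.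
have of_int D : D \in concepts B -> intent_listed D -> extent_listed D /\ intent_listed D.
  by move=> DB intD; split=> //; apply: extent_listed_of_intent.
elim: C => [D|C IHC D IHD|C IHC D IHD|C IHC|C IHC] CB.
- apply: (of_ext _ CB) => b; rewrite obj_in_canon_inc //.
  by split=> [|bD _ ->] //; apply.
- have [/IHC[extC _] /IHD[extD _]] := concepts_closed CB.
  exact/(of_ext _ CB)/meet_extent_listed.
- have [/IHC[_ intC] /IHD[_ intD]] := concepts_closed CB.
  exact/(of_int _ CB)/join_intent_listed.
- have /= argB := concepts_closed CB; have [extC _] := IHC argB.
  exact/(of_int _ CB)/dia_intent_listed.
- have /= argB := concepts_closed CB; have [_ intC] := IHC argB.
  exact/(of_ext _ CB)/box_extent_listed.
Qed.

Lemma canon_model_sat_pos t : Pos (embed_term t) \in B -> sat_term canon_model t.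
Proof.
case: t => [a x|x a|a x|a C|x C] //= tB.
- have CB := mem_concepts tB (subconcepts_refl C).
  by have [extC _] := canon_model_listed CB; apply/extC.
- have CB := mem_concepts tB (subconcepts_refl C).
  by have [_ intC] := canon_model_listed CB; apply/intC.
Qed.

Lemma canon_model_sat_neg t :
  ~ clash B -> Neg (embed_term t) \in B -> ~ sat_term canon_model t.
Proof.
move=> noclash; case: t => [a x|x a|a x|a C|x C] /= tB sat_t; apply: noclash.
- by exists (RBox (ONam a) (FNam x)).
- by exists (RDia (FNam x) (ONam a)).
- by exists (Inc (ONam a) (FNam x)).
- have CB := mem_concepts tB (subconcepts_refl C); have [extC _] := canon_model_listed CB.
  exists (Inc (ONam a) (FCls C)); split=> //; last exact: saturated1 (rule_neg_obj s tB).
  exact/(obj_in_canon_inc CB)/extC.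
- have CB := mem_concepts tB (subconcepts_refl C); have [_ intC] := canon_model_listed CB.
  exists (Inc (OCls C) (FNam x)); split=> //; last exact: saturated1 (rule_neg_feat s tB).
  exact/(feat_in_canon_inc CB)/intC.
Qed.

Lemma canon_model_sat_separation : sat_separation canon_model s.
Proof.
by case E: s => [b|y] p pB; apply: saturated1; [apply: rule_SA E _|apply: rule_SX E _].
Qed.

End CanonicalModel.

Lemma stuck_consistent (CN ON FN : eqType) (s : separation ON FN)
    (A : abox CN ON FN) B :
  derivation s (embed A) B -> ~ clash B -> (forall new, ~ applicable s B new) ->
  consistent A s.
Proof.
move=> /derivation_sub AB noclash stuck.
have saturated new : rule s B new -> {subset new <= B}.
  move=> r u newu; apply/negPn/negP => uB; apply: (stuck new); split=> //.
  by apply/hasP; exists u.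
exists (canon_model saturated); split; last exact: canon_model_sat_separation.
move=> [t|t] tA /=; [apply: canon_model_sat_pos|apply: canon_model_sat_neg => //];
  apply/AB/mapP; by [exists (Pos t)|exists (Neg t)].
Qed.

(** * Names as modal paths *)

Definition term_over (CN O F : Type) (P : O -> Prop) (Q : F -> Prop)
    (R : concept CN -> Prop) (t : term CN O F) : Prop :=
  match t with
  | RBox b y | RDia y b | Inc b y => P b /\ Q y
  | OIn b C => P b /\ R C
  | FIn y C => Q y /\ R C
  end.

Lemma term_over_impl2 (CN O F : Type) (P1 P2 P : O -> Prop) (Q1 Q2 Q : F -> Prop)
    (R1 R2 R : concept CN -> Prop) t :
  (forall b, P1 b -> P2 b -> P b) -> (forall y, Q1 y -> Q2 y -> Q y) ->
  (forall C, R1 C -> R2 C -> R C) ->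
  term_over P1 Q1 R1 t -> term_over P2 Q2 R2 t -> term_over P Q R t.
Proof.
by move=> PP QQ RR; case: t => [b y|y b|b y|b C|y C] /= [? ?] [? ?]; split; auto.
Qed.

Lemma term_over_impl (CN O F : Type) (P1 P : O -> Prop) (Q1 Q : F -> Prop)
    (R1 R : concept CN -> Prop) t :
  (forall b, P1 b -> P b) -> (forall y, Q1 y -> Q y) -> (forall C, R1 C -> R C) ->
  term_over P1 Q1 R1 t -> term_over P Q R t.
Proof. by move=> PP QQ RR over_t; apply: (term_over_impl2 _ _ _ over_t over_t); auto. Qed.

Section Paths.
Variables (CN ON FN : eqType).
Implicit Types (b : oname CN ON) (y : fname CN FN).

(* In a path true stands for LBox and Blk, false for Dia and Box. *)
Fixpoint obj_path b : seq bool :=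
  match b with
  | ODia b1 => false :: obj_path b1
  | OLBox b1 => true :: obj_path b1
  | _ => [::]
  end.

Fixpoint obj_base b : oname CN ON :=
  match b with ODia b1 | OLBox b1 => obj_base b1 | _ => b end.

Definition obj_extend (w : seq bool) b : oname CN ON :=
  foldr (fun c b1 => if c then OLBox b1 else ODia b1) b w.

Lemma obj_extend_base b : obj_extend (obj_path b) (obj_base b) = b.
Proof. by elim: b => //= b ->. Qed.

Lemma osize_extend w b : osize (obj_extend w b) = size w + osize b.
Proof. by elim: w => // -[] w /= ->. Qed.

Fixpoint obj_over (P : ON -> Prop) (Q : concept CN -> Prop) b : Prop :=
  match b with
  | ONam a => P a
  | OCls C => Q C
  | ODia b1 | OLBox b1 => obj_over P Q b1
  end.

Fixpoint mirror y : oname CN FN :=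
  match y with
  | FNam x => ONam x
  | FCls C => OCls C
  | FBox y1 => ODia (mirror y1)
  | FBlk y1 => OLBox (mirror y1)
  end.

Fixpoint unmirror (b : oname CN FN) : fname CN FN :=
  match b with
  | ONam x => FNam x
  | OCls C => FCls C
  | ODia b1 => FBox (unmirror b1)
  | OLBox b1 => FBlk (unmirror b1)
  end.

Lemma mirrorK : cancel mirror unmirror.
Proof. by elim=> //= y ->. Qed.

Lemma unmirrorK : cancel unmirror mirror.
Proof. by elim=> //= b ->. Qed.

Lemma osize_mirror y : osize (mirror y) = fsize y.
Proof. by elim: y => //= y ->. Qed.

End Paths.

Definition feat_path (CN FN : eqType) (y : fname CN FN) : seq bool :=
  obj_path (mirror y).

Definition feat_over (CN FN : eqType) (P : FN -> Prop) (Q : concept CN -> Prop)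
    (y : fname CN FN) : Prop :=
  obj_over P Q (mirror y).

Definition path_value (L : modal_algebra) (w : seq bool) (x : L) : L :=
  foldr (fun c : bool => if c then @mlbox L else @mdia L) x w.

(* In the opposite algebra mlbox and mdia are mblk and mbox. *)
Definition copath_value (L : modal_algebra) : seq bool -> L -> L :=
  @path_value (opposite L).

Lemma le_path_value (L : modal_algebra) (x : L) w :
  mle x (mdia x) -> mle x (mlbox x) -> mle x (path_value w x).
Proof.
move=> le_dia le_lbox; elim: w => [|[] w IHw] /=; first exact: mle_refl.
  exact: mle_trans le_lbox (mlbox_homo IHw).
exact: mle_trans le_dia (mdia_homo IHw).
Qed.

Section ValueBounds.
Variables (CN ON FN : eqType) (L : modal_algebra).
Variables (obj_val : ON -> L) (feat_val : FN -> L) (atom_val : CN -> L).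
Variables (P : ON -> Prop) (Q : FN -> Prop) (R : concept CN -> Prop).
Variables lo hi : L.
Hypothesis obj_ge : forall a, mle lo (obj_val a).
Hypothesis feat_le : forall x, mle (feat_val x) hi.
Hypothesis concept_ge : forall C, R C -> mle lo (concept_value atom_val C).
Hypothesis concept_le : forall C, R C -> mle (concept_value atom_val C) hi.
Hypothesis le_dia : mle lo (mdia lo).
Hypothesis le_lbox : mle lo (mlbox lo).
Hypothesis box_le : mle (mbox hi) hi.
Hypothesis blk_le : mle (mblk hi) hi.

Lemma path_value_le_obj b : obj_over P R b ->
  mle (path_value (obj_path b) lo) (obj_value obj_val atom_val b).
Proof.
elim: b => //= [b IHb|b IHb] Rb; [exact/mdia_homo/IHb|exact/mlbox_homo/IHb].
Qed.

Lemma obj_value_ge b : obj_over P R b -> mle lo (obj_value obj_val atom_val b).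
Proof. by move=> /path_value_le_obj; apply: mle_trans; apply: le_path_value. Qed.

Lemma feat_le_copath_value y : feat_over Q R y ->
  mle (feat_value feat_val atom_val y) (copath_value (feat_path y) hi).
Proof.
elim: y => //= [y IHy|y IHy] Ry; [exact/mbox_homo/IHy|exact/mblk_homo/IHy].
Qed.

Lemma feat_value_le y : feat_over Q R y -> mle (feat_value feat_val atom_val y) hi.
Proof.
move=> /feat_le_copath_value/mle_trans; apply.
exact: (@le_path_value (opposite L) hi (feat_path y) box_le blk_le).
Qed.

Lemma holds_path_bounds t : holds obj_val feat_val atom_val t ->
  term_over (obj_over P R) (feat_over Q R) R t ->
  term_over (fun b => mle (path_value (obj_path b) lo) hi)
    (fun y => mle lo (copath_value (feat_path y) hi)) (fun=> True) t.
Proof.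
have path_le b : obj_over P R b -> mle (obj_value obj_val atom_val b) hi ->
    mle (path_value (obj_path b) lo) hi.
  by move=> /path_value_le_obj; apply: mle_trans.
have copath_ge y : feat_over Q R y -> mle lo (feat_value feat_val atom_val y) ->
    mle lo (copath_value (feat_path y) hi).
  by move=> /feat_le_copath_value + lo_y; apply: mle_trans.
case: t => [b y|y b|b y|b C|y C] /= val_t [over_l over_r]; split=> //.
- apply: (path_le _ over_l); apply: mle_trans val_t (mle_trans _ box_le).
  exact/mbox_homo/feat_value_le.
- apply: (copath_ge _ over_r); apply: mle_trans le_lbox _; apply/mlbox_adj.
  exact: mle_trans (obj_value_ge over_l) val_t.
- apply: (path_le _ over_l); move/mdia_adj: val_t => val_t.
  apply: mle_trans val_t (mle_trans _ blk_le).
  exact/mblk_homo/feat_value_le.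
- apply: (copath_ge _ over_r); apply: mle_trans (mle_trans le_dia _) val_t.
  exact/mdia_homo/obj_value_ge.
- exact: path_le over_l (mle_trans val_t (feat_value_le over_r)).
- exact: copath_ge over_r (mle_trans (obj_value_ge over_l) val_t).
- exact: path_le over_l (mle_trans val_t (concept_le over_r)).
- exact: copath_ge over_l (mle_trans (concept_ge over_r) val_t).
Qed.

End ValueBounds.

(** * Algebras that bound the tableau *)

Definition obj_names (CN O F : eqType) (A : abox CN O F) : seq O :=
  flatten [seq term_obj (body u) | u <- A].
Definition feat_names (CN O F : eqType) (A : abox CN O F) : seq F :=
  flatten [seq term_feat (body u) | u <- A].

Lemma term_over_names (CN O F : eqType) (A : abox CN O F) :
  {in A, forall u, term_over [in obj_names A] [in feat_names A] [in concepts A] (body u)}.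
Proof.
move=> u uA.
have objP b : b \in term_obj (body u) -> b \in obj_names A.
  by move=> bu; apply/flatten_mapP; exists u.
have featP y : y \in term_feat (body u) -> y \in feat_names A.
  by move=> yu; apply/flatten_mapP; exists u.
case: (body u) objP featP (mem_concepts uA) => [b y|y b|b y|b C|y C] objP featP conceptP;
  split; by [apply: objP; rewrite mem_head|apply: featP; rewrite mem_head
            |apply: conceptP; apply: subconcepts_refl].
Qed.

Lemma embed_origin (CN ON FN : eqType) (A : abox CN ON FN) u :
  u \in embed A -> exists2 v, v \in A & body u = embed_term (body v).
Proof. by case/mapP=> [[t|t] tA ->]; [exists (Pos t)|exists (Neg t)]. Qed.

Definition modal_free (CN ON FN : eqType) :
    term CN (oname CN ON) (fname CN FN) -> Prop :=
  term_over (fun b => obj_path b = [::]) (fun y => feat_path y = [::]) (fun=> True).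

(* lo is the value of all object names and hi that of all feature names. *)
Record bounding (CN : eqType) (L : modal_algebra) (lo hi : L) (atom_val : CN -> L)
    (cs : seq (concept CN)) : Prop := Bounding {
  bounding_inc : mle lo hi;
  bounding_box : mle lo (mbox hi);
  bounding_SA : forall p, mle lo (mbox p) -> mle (mdia lo) p;
  bounding_SX : forall p, mle (mdia p) hi -> mle p (mbox hi);
  bounding_ge : {in cs, forall C, mle lo (concept_value atom_val C)};
  bounding_le : {in cs, forall C, mle (concept_value atom_val C) hi}
}.

Lemma bounding_sound (CN ON FN : eqType) (L : modal_algebra) (lo hi : L)
    (atom_val : CN -> L) (s : separation ON FN) (A : abox CN ON FN) B :
  bounding lo hi atom_val (concepts A) -> derivation s (embed A) B ->
  {in B, forall u,
    signed (holds (fun=> lo) (fun=> hi) atom_val) (@modal_free CN ON FN) u}.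
Proof.
case=> inc box SA_le SX_le ge le; apply: derivation_sound.
- by case: s.
- by move=> b C [].
- by move=> y C [].
move=> u /embed_origin[v /term_over_names]; case: u => t /= + ->; case: (body v) => //=.
- by move=> *; apply: SA_le.
- by move=> b C [_ /ge].
- by move=> y C [_ /le].
Qed.

Fixpoint dual (CN : Type) (C : concept CN) : concept CN :=
  match C with
  | Atom D => Atom D
  | Meet C1 C2 => Join (dual C1) (dual C2)
  | Join C1 C2 => Meet (dual C1) (dual C2)
  | Dia C1 => Box (dual C1)
  | Box C1 => Dia (dual C1)
  end.

Lemma concept_value_opposite (CN : eqType) (L : modal_algebra) (atom_val : CN -> L) C :
  concept_value (L := opposite L) atom_val C = concept_value atom_val (dual C).
Proof. by elim: C => //= [C -> D ->|C -> D ->|C ->|C ->]. Qed.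

Lemma bounding_opposite (CN : eqType) (L : modal_algebra) (lo hi : L)
    (atom_val : CN -> L) cs :
  bounding lo hi atom_val (map (@dual CN) cs) ->
  @bounding CN (opposite L) hi lo atom_val cs.
Proof.
case=> inc box SA_le SX_le ge le; split=> //=; first exact: SA_le.
  by move=> C C_cs; rewrite concept_value_opposite; apply/le/map_f.
by move=> C C_cs; rewrite concept_value_opposite; apply/ge/map_f.
Qed.

Lemma dual_closed (CN : eqType) (cs : seq (concept CN)) :
  subconcept_closed [in cs] -> subconcept_closed [in map (@dual CN) cs].
Proof.
move=> closed _ /mapP[C /closed C_cs ->]; case: C C_cs => //= [C D|C D|C|C];
  by [case=> *; split; apply: map_f|apply: map_f].
Qed.

(** ** The shape of paths *)

(* The values up to 5 are the states of an automaton reading the path of a name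
   from right to left: an object name gets a value below 5, the largest that
   matters, only if its path has the form [LBox] Dia^i LBox^j [e], and no feature
   name exceeds 4.  Larger values are fixed by the four maps. *)
Definition shape_box (v : nat) : nat := nth v [:: 0; 0; 2; 2; 3] v.
Definition shape_dia (v : nat) : nat := nth v [:: 0; 2; 3; 3; 5] v.
Definition shape_lbox (v : nat) : nat := nth v [:: 0; 2; 2; 4; 5] v.
Definition shape_blk (v : nat) : nat := nth v [:: 0; 0; 1; 3; 3] v.

Definition shape_chain : modal_algebra.
Proof.
apply: (@ModalAlgebra nat (fun u v => u <= v) minn maxn
  shape_box shape_dia shape_lbox shape_blk).
- by move=> x; apply: leqnn.
- by move=> y x z; apply: leq_trans.
- by move=> x y z; rewrite leq_min; split=> [/andP|[-> ->]].
- by move=> x y z; rewrite geq_max; split=> [/andP|[-> ->]].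
- by move=> [|[|[|[|[|x]]]]] [|[|[|[|[|y]]]]]; rewrite /shape_box /shape_lbox /= ?nth_nil.
- by move=> [|[|[|[|[|x]]]]] [|[|[|[|[|y]]]]]; rewrite /shape_dia /shape_blk /= ?nth_nil.
Defined.

Definition shape_value (CN : eqType) : concept CN -> nat :=
  @concept_value CN shape_chain (fun=> 2).

Lemma shape_value_range (CN : eqType) (C : concept CN) : 2 <= shape_value C <= 3.
Proof.
rewrite /shape_value; elim: C => //= [C + D|C + D|C|C].
- by move: (concept_value _ C) (concept_value _ D) => /= u v; lia.
- by move: (concept_value _ C) (concept_value _ D) => /= u v; lia.
- by case: (concept_value _ C) => [|[|[|[|v]]]].
- by case: (concept_value _ C) => [|[|[|[|v]]]].
Qed.

Lemma shape_bounding (CN : eqType) (cs : seq (concept CN)) :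
  @bounding CN shape_chain 1 4 (fun=> 2) cs.
Proof.
split=> [||p|p|C _|C _] //.
- by case: p => [|[|[|[|[|p]]]]] //=; rewrite /shape_box /= nth_nil.
- by case: p => [|[|[|[|[|p]]]]] //=; rewrite /shape_dia /= nth_nil.
- by have /andP[/ltnW] := shape_value_range C.
- by have /andP[_ /leqW] := shape_value_range C.
Qed.

Definition shape_path (w : seq bool) : nat := @path_value shape_chain w 1.

Definition shape_language (v : nat) (w : seq bool) : Prop :=
  match v with
  | 0 => False
  | 1 => w = [::]
  | 2 => exists j c, w = rcons (nseq j true) c
  | 3 => exists i j c, w = nseq i false ++ rcons (nseq j true) c
  | 4 => exists i j c, w = true :: nseq i false ++ rcons (nseq j true) c
  | _ => True
  end.

Lemma shape_path_language w : shape_language (shape_path w) w.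
Proof.
elim: w => //= c w; rewrite /shape_path /= -/(shape_path w).
case: (shape_path w) => [|[|[|[|[|v]]]]] //=.
- by move=> ->; case: c; [exists 0, true|exists 0, false].
- by case=> j [d ->]; case: c; [exists j.+1, d|exists 1, j, d].
- by case=> i [j [d ->]]; case: c; [exists i, j, d|exists i.+1, j, d].
- by case: c.
- by case: c; rewrite /shape_dia /shape_lbox /= nth_nil.
Qed.

(* The map v |-> 5 - v exchanges shape_dia with shape_box and shape_lbox with
   shape_blk. *)
Lemma shape_copath w : @copath_value shape_chain w 4 = 5 - shape_path w.
Proof.
suff [] : shape_path w <= 5 /\ @copath_value shape_chain w 4 = 5 - shape_path w by [].
rewrite /shape_path /copath_value; elim: w => //= c w [le5 ->]; move: le5.
by case: (path_value w _) => [|[|[|[|[|[|v]]]]]] //=; case: c.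
Qed.

Lemma shape_path_bounds (CN ON FN : eqType) (P : ON -> Prop) (Q : FN -> Prop)
    (R : concept CN -> Prop) t :
  holds (L := shape_chain) (fun=> 1) (fun=> 4) (fun=> 2) t ->
  term_over (obj_over P R) (feat_over Q R) R t ->
  term_over (fun b => shape_path (obj_path b) <= 4)
    (fun y => shape_path (feat_path y) <= 4) (fun=> True) t.
Proof.
move=> hold_t over_t.
apply: term_over_impl (holds_path_bounds (L := shape_chain) (lo := 1) (hi := 4)
  _ _ _ _ _ _ _ _ hold_t over_t)
  => [b|y|C|a|x|C _|C _||||] //=.
- by rewrite shape_copath; lia.
- by have /andP[/ltnW] := shape_value_range C.
- by have /andP[_ /leqW] := shape_value_range C.
Qed.

Definition path_shapes (N : nat) : seq (seq bool) :=
  [seq u ++ v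
  | u <- [seq e ++ nseq i false | e <- [:: [::]; [:: true]], i <- iota 0 N.+1],
    v <- [seq nseq j true ++ e
         | j <- iota 0 N.+1, e <- [:: [::]; [:: true]; [:: false]]]].

Lemma size_path_shapes N : size (path_shapes N) = (2 * N.+1) * (N.+1 * 3).
Proof. by rewrite !size_allpairs !size_iota. Qed.

Lemma size_path_shape N w : w \in path_shapes N -> size w <= 2 * N.+1.
Proof.
case/allpairsP=> -[u v] [/allpairsP[[e i] [e_in + ->]]].
rewrite mem_iota => i_le /allpairsP[[j e'] [+ e'_in ->]] ->.
rewrite mem_iota => j_le; rewrite !size_cat !size_nseq.
move: i_le j_le e_in e'_in; rewrite !inE /=.
by move=> ? ? /orP[] /eqP-> /or3P[] /eqP-> /=; lia.
Qed.

Lemma mem_path_shapes N w : shape_path w <= 4 -> size w <= N -> w \in path_shapes N.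
Proof.
have build i j (e e' : seq bool) : e \in [:: [::]; [:: true]] ->
    e' \in [:: [::]; [:: true]; [:: false]] -> i <= N -> j <= N ->
    (e ++ nseq i false) ++ nseq j true ++ e' \in path_shapes N.
  move=> e_in e'_in iN jN; apply: allpairs_f; apply/allpairsP;
    by [exists (e, i); split; rewrite // mem_iota
       |exists (j, e'); split; rewrite // mem_iota].
have letter c : [:: c] \in [:: [::]; [:: true]; [:: false]] by case: c.
move: (shape_path_language w); case: (shape_path w) => [|[|[|[|[|v]]]]] //=.
- by move=> -> _ _; apply: (build 0 0 [::] [::]).
- case=> j [c ->] _; rewrite -cats1 size_cat size_nseq => /= jN.
  by apply: (build 0 j [::] [:: c]) => //; lia.
- case=> i [j [c ->]] _; rewrite -cats1 !size_cat !size_nseq => /= jN.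
  by apply: (build i j [::] [:: c]) => //; lia.
- case=> i [j [c ->]] _; rewrite -cats1 /= !size_cat !size_nseq => /= jN.
  by apply: (build i j [:: true] [:: c]) => //; lia.
Qed.

(** ** The length of paths *)

Definition depth_chain : modal_algebra.
Proof.
apply: (@ModalAlgebra Z Z.le Z.min Z.max Z.pred Z.succ Z.succ Z.pred); lia.
Defined.

Definition depth_value (CN : eqType) : concept CN -> Z :=
  @concept_value CN depth_chain (fun=> 0%Z).

Lemma depth_value_range (CN : eqType) (C : concept CN) d : csize C <= d ->
  (- Z.of_nat d <= depth_value C <= Z.of_nat d)%Z.
Proof.
suff : (- Z.of_nat (csize C) <= depth_value C <= Z.of_nat (csize C))%Z by lia.
rewrite /depth_value; elim: C => //= [C + D|C + D|C|C].
- by move: (concept_value _ C) (concept_value _ D) => /= u v; lia.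
- by move: (concept_value _ C) (concept_value _ D) => /= u v; lia.
- by move: (concept_value _ C) => /= u; lia.
- by move: (concept_value _ C) => /= u; lia.
Qed.

Lemma depth_bounding (CN : eqType) (cs : seq (concept CN)) d :
  0 < d -> {in cs, forall C, csize C <= d} ->
  @bounding CN depth_chain (- Z.of_nat d)%Z (Z.of_nat d) (fun=> 0%Z) cs.
Proof.
move=> d_gt0 size_cs; split=> [||p|p|C /size_cs|C /size_cs] /=; try lia.
- by move=> /depth_value_range[].
- by move=> /depth_value_range[].
Qed.

Lemma depth_path w x : @path_value depth_chain w x = (x + Z.of_nat (size w))%Z.
Proof. by elim: w => [|[] w IHw] /=; rewrite ?IHw; lia. Qed.

Lemma depth_copath w x : @copath_value depth_chain w x = (x - Z.of_nat (size w))%Z.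
Proof. by rewrite /copath_value; elim: w => [|[] w IHw] /=; rewrite ?IHw; lia. Qed.

Lemma depth_path_bounds (CN ON FN : eqType) (P : ON -> Prop) (Q : FN -> Prop)
    (R : concept CN -> Prop) d t :
  (forall C, R C -> csize C <= d) ->
  holds (L := depth_chain) (fun=> - Z.of_nat d)%Z (fun=> Z.of_nat d) (fun=> 0%Z) t ->
  term_over (obj_over P R) (feat_over Q R) R t ->
  term_over (fun b => size (obj_path b) <= 2 * d)
    (fun y => size (feat_path y) <= 2 * d) (fun=> True) t.
Proof.
move=> size_R hold_t over_t.
apply: term_over_impl (holds_path_bounds (L := depth_chain)
  (lo := (- Z.of_nat d)%Z) (hi := Z.of_nat d) _ _ _ _ _ _ _ _ hold_t over_t)
  => [b|y|C|a|x|C /size_R|C /size_R||||] //=; try lia.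
- by rewrite depth_path; lia.
- by rewrite depth_copath; lia.
- by move=> /depth_value_range[].
- by move=> /depth_value_range[].
Qed.

(** ** The concepts created by the adjunction rules *)

Section KripkeAlgebra.
Variables (W : Type) (rb rd : W -> W -> Prop).
Implicit Types e f g : W -> Prop.

Definition kripke_le e f : Prop := forall p, e p -> f p.
Definition kripke_box e p : Prop := forall q, rb p q -> e q.
Definition kripke_dia e p : Prop := exists2 q, rd p q & e q.
Definition kripke_lbox e q : Prop := exists2 p, rb p q & e p.
Definition kripke_blk e q : Prop := forall p, rd p q -> e p.

Lemma kripke_le_and e f g :
  kripke_le g (fun p => e p /\ f p) <-> kripke_le g e /\ kripke_le g f.
Proof.
split=> [ge|[ge gf] p gp]; first by split=> p /ge[].
by split; [apply: ge|apply: gf].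
Qed.

Lemma kripke_or_le e f g :
  kripke_le (fun p => e p \/ f p) g <-> kripke_le e g /\ kripke_le f g.
Proof.
split=> [le|[eg fg] p [/eg|/fg] //].
by split=> p ?; apply: le; [left|right].
Qed.

Lemma kripke_lbox_adj e f : kripke_le (kripke_lbox e) f <-> kripke_le e (kripke_box f).
Proof.
split=> [le p e_p q pq|le q [p pq e_p]]; first by apply: le; exists p.
exact: le pq.
Qed.

Lemma kripke_dia_adj e f : kripke_le (kripke_dia e) f <-> kripke_le e (kripke_blk f).
Proof.
split=> [le q e_q p pq|le p [q pq e_q]]; first by apply: le; exists q.
exact: le pq.
Qed.

Definition kripke_algebra : modal_algebra :=
  @ModalAlgebra (W -> Prop) kripke_le _ _ _ _ _ _ (fun e p => id)
    (fun f e g ef fg p ep => fg p (ef p ep))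
    kripke_le_and kripke_or_le kripke_lbox_adj kripke_dia_adj.

End KripkeAlgebra.

(* In a word true stands for Box, false for Dia. *)
Fixpoint branches (CN : Type) (C : concept CN) : seq (seq bool) :=
  match C with
  | Atom _ => [:: [::]]
  | Meet C1 C2 | Join C1 C2 => branches C1 ++ branches C2
  | Dia C1 => map (cons false) (branches C1)
  | Box C1 => map (cons true) (branches C1)
  end.

Definition branch_words (CN : Type) (cs : seq (concept CN)) : seq (seq bool) :=
  flatten [seq branches C | C <- cs].

Lemma branches_dual (CN : Type) (C : concept CN) :
  branches (dual C) = map (map negb) (branches C).
Proof.
by elim: C => //= [C -> D ->|C -> D ->|C ->|C ->]; rewrite ?map_cat // -!map_comp.
Qed.

Lemma branch_words_dual (CN : eqType) (cs : seq (concept CN)) :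
  branch_words (map (@dual CN) cs) = map (map negb) (branch_words cs).
Proof.
rewrite /branch_words map_flatten -!map_comp; congr flatten.
by apply: eq_map => C /=; rewrite branches_dual.
Qed.

(* Every world has a Box-edge to the empty word and None has a Dia-edge to every
   world, so that whatever lies below a Box is evaluated at the empty word. *)
Definition word_box (p q : option (seq bool)) : Prop :=
  match p, q with
  | Some v, Some w => w = rcons v true \/ w = [::]
  | None, Some w => w = [::]
  | None, None => True
  | Some _, None => False
  end.
Definition word_dia (p q : option (seq bool)) : Prop :=
  match p, q with
  | Some v, Some w => w = rcons v false
  | None, _ => True
  | Some _, None => False
  end.
Definition word_algebra : modal_algebra := kripke_algebra word_box word_dia.

Definition word_none : word_algebra := fun p => p = None.
Definition word_root : word_algebra := fun p => p = None \/ p = Some [::].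
Definition word_atom (CN : eqType) (cs : seq (concept CN)) (D : CN) : word_algebra :=
  fun p => if p is Some w then w \in branch_words cs else True.

Lemma word_none_le_dia : mle word_none (mdia word_none).
Proof. by move=> _ ->; exists None. Qed.

Lemma word_none_le_lbox : mle word_none (mlbox word_none).
Proof. by move=> _ ->; exists None. Qed.

Lemma word_dia_root : mle (mdia word_root) word_none.
Proof. by case=> [v|] // [[w|] // vw [] // [w_nil]]; case: v vw => //; rewrite w_nil. Qed.

Definition forces (CN : eqType) (cs : seq (concept CN)) (p : option (seq bool))
    (C : concept CN) : Prop :=
  concept_value (word_atom cs) C p.

Lemma forces_branch (CN : eqType) (cs : seq (concept CN)) (C : concept CN) v :
  forces cs (Some v) C -> exists2 q, q \in branches C & v ++ q \in branch_words cs.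
Proof.
elim: C v => [N|C IHC D IHD|C IHC D IHD|C IHC|C IHC] v.
- by move=> vN; exists [::]; rewrite ?cats0 ?mem_head.
- by case=> /IHC[q qC vq] _; exists q; rewrite // mem_cat qC.
- by case=> [/IHC[q qC vq]|/IHD[q qD vq]]; exists q; rewrite // mem_cat ?qC ?qD ?orbT.
- case=> -[w|] //= -> /IHC[q qC]; rewrite cat_rcons => vq.
  by exists (false :: q); rewrite ?map_f.
- move=> /(_ (Some (rcons v true)) (or_introl erefl))/IHC[q qC].
  by rewrite cat_rcons => vq; exists (true :: q); rewrite ?map_f.
Qed.

Section Forcing.
Variables (CN : eqType) (cs : seq (concept CN)).
Hypothesis closed_cs : subconcept_closed [in cs].

Lemma forces_of_branches C w : C \in cs ->
  {in branches C, forall q, w ++ q \in branch_words cs} -> forces cs (Some w) C.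
Proof.
elim: C w => [N|C IHC D IHD|C IHC D IHD|C IHC|C IHC] w C_cs wC.
- by move: (wC [::]); rewrite cats0; apply; rewrite mem_head.
- have [arg_cs D_cs] := closed_cs C_cs.
  by split; [apply: IHC|apply: IHD] => // q qC; apply: wC; rewrite mem_cat qC ?orbT.
- have [arg_cs _] := closed_cs C_cs.
  by left; apply: IHC => // q qC; apply: wC; rewrite mem_cat qC.
- exists (Some (rcons w false)) => //; apply: (IHC _ (closed_cs C_cs)) => q qC.
  by rewrite cat_rcons; apply/wC/map_f.
- move=> [v|] //= [->|->]; apply: (IHC _ (closed_cs C_cs)) => q qC.
    by rewrite cat_rcons; apply/wC/map_f.
  by apply/flatten_mapP; exists C => //; apply: (closed_cs C_cs).
Qed.

Lemma forces_nil C : C \in cs -> forces cs (Some [::]) C.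
Proof.
by move=> C_cs; apply: forces_of_branches => // q qC; apply/flatten_mapP; exists C.
Qed.

Lemma forces_none C : C \in cs -> forces cs None C.
Proof.
elim: C => [N|C IHC D IHD|C IHC D IHD|C IHC|C IHC] /closed_cs //=.
- by case=> /IHC ? /IHD ?; split.
- by case=> /IHC ? _; left.
- by move=> /IHC ?; exists None.
- by move=> C_cs [v /= ->|_]; [apply: forces_nil|apply: IHC].
Qed.

Lemma word_bounding :
  @bounding CN word_algebra word_root (fun=> True) (word_atom cs) cs.
Proof.
split=> // [p box_p q /word_dia_root ->|C C_cs _ [->|->]].
- by apply: (box_p None); first by left.
- exact: forces_none.
- exact: forces_nil.
Qed.

(* The adjunction rules create x_(Box C) and a_(Dia C) under the respective
   forcing conditions only. *)
Inductive generated : concept CN -> Prop :=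
| generated_in C : C \in cs -> generated C
| generated_box C : generated C -> forces cs (Some [::]) C -> generated (Box C)
| generated_dia C : generated C -> forces (map (@dual CN) cs) (Some [::]) (dual C) ->
    generated (Dia C).

Lemma generated_closed : subconcept_closed generated.
Proof.
move=> _ [C /closed_cs|C|C] //=.
by case: C => //= [C D|C D|C|C]; [case=> ? ?; split|case=> ? ?; split|..];
  apply: generated_in.
Qed.

Lemma generated_forces_none C : generated C -> forces cs None C.
Proof.
elim=> {C} [C|C _ IHC nilC|C _ IHC _]; first exact: forces_none.
  by case=> [v /= ->|].
by exists None.
Qed.

End Forcing.

Section GeneratedConcepts.
Variables (CN : eqType) (cs : seq (concept CN)).
Hypothesis closed_cs : subconcept_closed [in cs].

Lemma generated_dual_forces_none C :
  generated cs C -> forces (map (@dual CN) cs) None (dual C).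
Proof.
elim=> {C} [C C_cs|C _ IHC _|C _ IHC nilC].
- by apply: forces_none; [apply: dual_closed|apply: map_f].
- by exists None.
- by case=> [v /= ->|].
Qed.

Definition concept_extend (w : seq bool) (C : concept CN) : concept CN :=
  foldr (fun c D => if c then Box D else Dia D) C w.

Lemma csize_extend w C : csize (concept_extend w C) = size w + csize C.
Proof. by elim: w => // -[] w /= ->. Qed.

Lemma branches_extend w C : branches (concept_extend w C) = map (cat w) (branches C).
Proof. by elim: w => [|[] w /= ->]; rewrite -?map_comp ?map_id. Qed.

Lemma generated_extend C : generated cs C ->
  exists w D, D \in cs /\ C = concept_extend w D.
Proof.
elim=> {C} [C C_cs|C _ [w [D [D_cs ->]]] _|C _ [w [D [D_cs ->]]] _].
- by exists [::], C.
- by exists (true :: w), D.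
- by exists (false :: w), D.
Qed.

Definition new_words (n : nat) : seq (seq bool) :=
  [seq c :: w | c <- [:: true; false],
                w <- [seq take i q | i <- iota 0 n.+1, q <- branch_words cs]].

Definition generated_list (n : nat) : seq (concept CN) :=
  cs ++ [seq concept_extend w C | w <- new_words n, C <- cs].

Lemma size_generated_list n :
  size (generated_list n) = size cs + 2 * (n.+1 * size (branch_words cs)) * size cs.
Proof. by rewrite size_cat !size_allpairs size_iota. Qed.

Variable n : nat.
Hypothesis size_word : {in branch_words cs, forall q, size q <= n}.

Lemma mem_generated_list_cons c C : generated cs C ->
  (exists2 q, q \in branches C & q \in branch_words cs) ->
  concept_extend [:: c] C \in generated_list n.
Proof.
move=> /generated_extend[w [D [D_cs ->]]] [q].
rewrite branches_extend => /mapP[r _ ->] q_words.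
rewrite mem_cat -[concept_extend [:: c] _]/(concept_extend (c :: w) D); apply/orP; right.
apply: allpairs_f => //; apply: allpairs_f; first by case: c; rewrite !inE.
rewrite -[w](take_size_cat r (erefl (size w))); apply: allpairs_f => //.
rewrite mem_iota ltnS; apply: leq_trans (size_word q_words).
by rewrite size_cat leq_addr.
Qed.

Lemma mem_generated_list C : generated cs C -> C \in generated_list n.
Proof.
case=> {C} [C C_cs|C genC nilC|C genC nilC]; first by rewrite mem_cat C_cs.
  apply: (mem_generated_list_cons true) genC _.
  by have [q] := forces_branch nilC; exists q.
apply: (mem_generated_list_cons false) genC _; have [q + /=] := forces_branch nilC.
rewrite branches_dual branch_words_dual => /mapP[r rC ->].
by rewrite mem_map => [|? ?]; [exists r|apply/inj_map; case=> [] []].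
Qed.

Lemma csize_generated_list : {in cs, forall C, csize C <= n} ->
  {in generated_list n, forall C, csize C <= 2 * n + 1}.
Proof.
move=> size_cs C; rewrite mem_cat => /orP[/size_cs|]; first by lia.
case/allpairsP=> -[w D] [/allpairsP[[c v] [_ v_in def_w]] D_cs ->].
case/allpairsP: v_in => -[i q] [_ q_words def_v].
rewrite csize_extend def_w /= [v]def_v size_take_min.
have /= := size_word q_words; have /= := size_cs _ D_cs; lia.
Qed.

End GeneratedConcepts.

(** * The assertions that occur in the tableau *)

Section Sizes.
Variables (CN ON FN : eqType).
Implicit Types (B : tabox CN ON FN) (C D : concept CN).

Lemma size_subconcepts C : size (subconcepts C) = csize C.
Proof. by elim: C => //= [C <- D <-|C <- D <-|C ->|C ->] //; rewrite size_cat. Qed.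

Lemma csize_subconcepts C : {in subconcepts C, forall D, csize D <= csize C}.
Proof.
move=> D; elim: C => [N|C IHC E IHE|C IHC E IHE|C IHC|C IHC] /=;
  rewrite in_cons ?mem_cat => /predU1P[->|] //=.
- by case/orP=> [/IHC|/IHE]; lia.
- by case/orP=> [/IHC|/IHE]; lia.
- by move/IHC; lia.
- by move/IHC; lia.
Qed.

Lemma size_branches C : size (branches C) <= csize C.
Proof. by elim: C => //= *; rewrite ?size_cat ?size_map; lia. Qed.

Lemma size_branch C : {in branches C, forall q, size q <= csize C}.
Proof.
elim: C => [N|C IHC D IHD|C IHC D IHD|C IHC|C IHC] q /=.
- by rewrite inE => /eqP->.
- by rewrite mem_cat => /orP[/IHC|/IHD] /=; lia.
- by rewrite mem_cat => /orP[/IHC|/IHD] /=; lia.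
- by case/mapP=> r /IHC /= ? ->.
- by case/mapP=> r /IHC /= ? ->.
Qed.

Lemma size_branch_words (cs : seq (concept CN)) n :
  {in cs, forall C, csize C <= n} -> size (branch_words cs) <= size cs * n.
Proof.
elim: cs => //= C cs IH /forall_cons[C_le /IH cs_le].
by rewrite /branch_words /= size_cat mulSn leq_add // (leq_trans (size_branches C)).
Qed.

Lemma tsize_asize B : {in B, forall u, tsize u <= asize B}.
Proof.
by move=> u; rewrite /asize; elim: B => //= v B IH; rewrite inE => /predU1P[->|/IH]; lia.
Qed.

Lemma asize_bound B z : {in B, forall u, tsize u <= z} -> asize B <= size B * z.
Proof.
rewrite /asize; elim: B => //= u B IH /forall_cons[u_le /IH B_le].
by rewrite mulSn leq_add.
Qed.

Lemma size_asize B : size B <= asize B.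
Proof. by rewrite /asize; elim: B => //= u B; rewrite /tsize; lia. Qed.

Lemma size_concepts B : size (concepts B) <= asize B.
Proof.
rewrite /asize /concepts; elim: B => //= u B IH; rewrite size_cat leq_add //.
by rewrite /tsize; case: (body u) => //= *; rewrite size_subconcepts; lia.
Qed.

Lemma csize_concepts B :
  {in concepts B, forall C, exists2 u, u \in B & csize C <= tsize u}.
Proof.
move=> C /flatten_mapP[u uB Cu]; exists u => //; move: Cu; rewrite /tsize.
by case: (body u) => //= ? D /csize_subconcepts; lia.
Qed.

Lemma concepts_embed (A : abox CN ON FN) : concepts (embed A) = concepts A.
Proof.
rewrite /concepts /embed -map_comp; congr flatten.
by apply: eq_map => -[[]|[]].
Qed.

Lemma csize_abox (A : abox CN ON FN) : {in concepts A, forall C, csize C <= abox_size A}.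
Proof.
move=> C; rewrite -concepts_embed => /csize_concepts[u /tsize_asize uA Cu].
exact: leq_trans Cu uA.
Qed.

Lemma size_branch_abox (A : abox CN ON FN) :
  {in branch_words (concepts A), forall q, size q <= abox_size A}.
Proof.
move=> q /flatten_mapP[C /csize_abox C_le /size_branch q_le].
exact: leq_trans q_le C_le.
Qed.

End Sizes.

Section NameLists.
Variables (CN N : eqType).
Implicit Types (names : seq N) (ds : seq (concept CN)) (ws : seq (seq bool)).

Definition obj_list names ds ws : seq (oname CN N) :=
  [seq obj_extend w b | b <- map (@ONam CN N) names ++ map (@OCls CN N) ds, w <- ws].

Definition feat_list names ds ws : seq (fname CN N) :=
  map (@unmirror CN N) (obj_list names ds ws).

Lemma mem_obj_list names ds ws (Q : concept CN -> Prop) b :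
  (forall C, Q C -> C \in ds) -> obj_over [in names] Q b -> obj_path b \in ws ->
  b \in obj_list names ds ws.
Proof.
move=> Q_ds over_b path_b; rewrite -[b]obj_extend_base; apply: allpairs_f => //.
rewrite mem_cat; elim: b over_b {path_b} => //= [a a_names|C QC].
  by rewrite map_f.
by rewrite orbC map_f // Q_ds.
Qed.

Lemma mem_feat_list names ds ws (Q : concept CN -> Prop) y :
  (forall C, Q C -> C \in ds) -> feat_over [in names] Q y -> feat_path y \in ws ->
  y \in feat_list names ds ws.
Proof.
by move=> Q_ds over_y path_y; rewrite -[y]mirrorK; apply/map_f/(mem_obj_list Q_ds).
Qed.

Lemma size_obj_list names ds ws :
  size (obj_list names ds ws) = (size names + size ds) * size ws.
Proof. by rewrite size_allpairs size_cat !size_map. Qed.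

Lemma size_feat_list names ds ws :
  size (feat_list names ds ws) = (size names + size ds) * size ws.
Proof. by rewrite size_map size_obj_list. Qed.

Lemma osize_obj_list names ds ws k d :
  {in ws, forall w, size w <= k} -> {in ds, forall C, csize C <= d} ->
  {in obj_list names ds ws, forall b, osize b <= k + d.+1}.
Proof.
move=> size_ws size_ds _ /allpairsP[[b w] /= [b_in /size_ws w_le ->]].
rewrite osize_extend leq_add //; move: b_in; rewrite mem_cat.
by case/orP=> /mapP[c c_in ->] //=; rewrite ltnS; apply: size_ds.
Qed.

Lemma fsize_feat_list names ds ws k d :
  {in ws, forall w, size w <= k} -> {in ds, forall C, csize C <= d} ->
  {in feat_list names ds ws, forall y, fsize y <= k + d.+1}.
Proof.
move=> size_ws size_ds _ /mapP[b b_in ->].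
by rewrite -osize_mirror unmirrorK; apply: osize_obj_list b_in.
Qed.

End NameLists.

Section AssertionLists.
Variables (CN O F : eqType) (os : seq O) (fs : seq F) (ds : seq (concept CN)).

Definition term_list : seq (term CN O F) :=
  [seq RBox b y | b <- os, y <- fs] ++ [seq RDia y b | y <- fs, b <- os] ++
  [seq Inc b y | b <- os, y <- fs] ++
  [seq OIn b C | b <- os, C <- ds] ++ [seq FIn y C | y <- fs, C <- ds].

Definition assertion_list : abox CN O F := map Pos term_list ++ map Neg term_list.

Lemma mem_assertion_list u :
  u \in assertion_list <-> term_over [in os] [in fs] [in ds] (body u).
Proof.
have -> : (u \in assertion_list) = (body u \in term_list).
  have [PosI NegI] : injective (@Pos CN O F) /\ injective (@Neg CN O F).
    by split=> t t' [].
  rewrite mem_cat; case: u => t /=.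
    rewrite (mem_map PosI) orb_idr // => /mapP[] //.
  by rewrite (mem_map NegI) orb_idl // => /mapP[].
rewrite /term_list !mem_cat; split.
  by do ?[case/orP]; case/allpairsP=> -[l r] /= [? ? ->].
by case: (body u) => [b y|y b|b y|b C|y C] /= [? ?];
  repeat first [by apply: allpairs_f|by apply/orP; left; apply: allpairs_f
               |apply/orP; right].
Qed.

Lemma size_assertion_list : size assertion_list =
  2 * (3 * (size os * size fs) + size os * size ds + size fs * size ds).
Proof. by rewrite size_cat !size_map !size_cat !size_allpairs; lia. Qed.

End AssertionLists.

Definition concept_size_bound (n : nat) : nat := 2 * n + 1.
Definition assertion_size_bound (n : nat) : nat := 10 * concept_size_bound n + 8.

Section Universe.
Variables (CN ON FN : eqType) (s : separation ON FN) (A : abox CN ON FN).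
Local Notation cs := (concepts A).
Local Notation dual_concepts := (map (@dual CN) (concepts A)).
Implicit Types (B new : tabox CN ON FN) (b : oname CN ON) (y : fname CN FN).
Implicit Type t : term CN (oname CN ON) (fname CN FN).

Let closed_cs : subconcept_closed [in cs] := concepts_closed (A := A).
Let closed_generated : subconcept_closed (generated cs) := generated_closed closed_cs.

Definition generated_obj : oname CN ON -> Prop :=
  obj_over [in obj_names A] (generated cs).
Definition generated_feat : fname CN FN -> Prop :=
  feat_over [in feat_names A] (generated cs).
Definition generated_term : term CN (oname CN ON) (fname CN FN) -> Prop :=
  term_over generated_obj generated_feat (generated cs).

Definition holds_word : term CN (oname CN ON) (fname CN FN) -> Prop :=
  holds (fun=> word_root) (fun _ => (fun=> True) : word_algebra) (word_atom cs).
Definition holds_coword : term CN (oname CN ON) (fname CN FN) -> Prop :=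
  holds (L := opposite word_algebra) (fun _ => (fun=> True) : word_algebra)
    (fun=> word_root) (word_atom dual_concepts).

Lemma generated_embed : {in embed A, forall u, generated_term (body u)}.
Proof.
move=> u /embed_origin[v /term_over_names + ->].
by case: (body v) => [a x|x a|a x|a C|x C] [? ?]; split=> //; apply: generated_in.
Qed.

Lemma generated_of_odia b : generated_obj (odia b) -> generated_obj b.
Proof. by case: b => // C /closed_generated. Qed.

Lemma generated_of_fbox y : generated_feat (fbox y) -> generated_feat y.
Proof. by case: y => // C /closed_generated. Qed.

Lemma generated_odia b y : generated_obj b -> generated_feat y ->
  holds_coword (RDia y b) -> generated_obj (odia b).
Proof.
case: b => // C gen_C gen_y; rewrite /holds_coword /= concept_value_opposite => y_le.
apply: generated_dia gen_C _; apply: (y_le None); last by [].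
apply: (feat_value_le (L := opposite word_algebra) (hi := word_none) _ _ _ _ gen_y) => //.
- by move=> x p ->; left.
- by move=> D /(generated_dual_forces_none closed_cs) ? _ ->;
    rewrite concept_value_opposite.
- exact: word_none_le_dia.
- exact: word_none_le_lbox.
Qed.

Lemma generated_fbox b y : generated_obj b -> generated_feat y ->
  holds_word (RBox b y) -> generated_feat (fbox y).
Proof.
case: y => // C gen_b gen_C; rewrite /holds_word /= => b_le.
apply: generated_box gen_C _; apply: (b_le None); last by [].
apply: (obj_value_ge (L := word_algebra) (lo := word_none) _ _ _ _ gen_b) => //.
- by move=> x p ->; left.
- by move=> D /(generated_forces_none closed_cs) ? _ ->.
- exact: word_none_le_dia.
- exact: word_none_le_lbox.
Qed.

Lemma generated_concepts B : {in B, forall u, generated_term (body u)} ->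
  {in concepts B, forall C, generated cs C}.
Proof.
move=> gen_B C /flatten_mapP[u /gen_B].
case: (body u) => //= [b D|y D] [_ gen_D];
  exact: (subconcept_closed_trans closed_generated gen_D).
Qed.

Lemma rule_generated B new : {in B, forall u, generated_term (body u)} ->
  (forall t, Pos t \in B -> holds_word t /\ holds_coword t) ->
  rule s B new -> {in new, forall u, generated_term (body u)}.
Proof.
move=> gen_B words_B; case.
- by move=> C /(generated_concepts gen_B) ?; apply/forall_seq2.
- by move=> b y C /gen_B[? _] /gen_B[? _]; apply/forall_seq1.
- by move=> b C1 C2 /gen_B[? /closed_generated[? ?]]; apply/forall_seq2.
- by move=> y C1 C2 /gen_B[? /closed_generated[? ?]]; apply/forall_seq2.
- by move=> b C1 C2 /gen_B[? _] _ /(generated_concepts gen_B) ?; apply/forall_seq1.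
- by move=> y C1 C2 /gen_B[? _] _ /(generated_concepts gen_B) ?; apply/forall_seq1.
- by move=> b y C /gen_B[? _] /gen_B[? _]; apply/forall_seq1.
- by move=> b y C /gen_B[? _] /gen_B[? _]; apply/forall_seq1.
- move=> b y by_B; have [gen_b gen_y] := gen_B _ by_B; have [by_word _] := words_B _ by_B.
  by apply/forall_seq2; split; split=> //; apply: generated_fbox by_word.
- move=> b y yb_B; have [gen_y gen_b] := gen_B _ yb_B; have [_ yb_word] := words_B _ yb_B.
  by apply/forall_seq2; split; split=> //; apply: generated_odia yb_word.
- by move=> b y /gen_B[? /generated_of_fbox ?]; apply/forall_seq1.
- by move=> b y /gen_B[? ?]; apply/forall_seq1.
- by move=> b y /gen_B[? ?]; apply/forall_seq1.
- by move=> b y /gen_B[/generated_of_odia ? ?]; apply/forall_seq1.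
- by move=> b C /gen_B[? ?]; apply/forall_seq1.
- by move=> y C /gen_B[? ?]; apply/forall_seq1.
- by move=> b C /gen_B[? ?]; apply/forall_seq1.
- by move=> y C /gen_B[? ?]; apply/forall_seq1.
- by move=> b y _ /gen_B[? ?]; apply/forall_seq1.
- by move=> y b _ /gen_B[? ?]; apply/forall_seq1.
Qed.

Lemma derivation_words B : derivation s (embed A) B ->
  forall t, Pos t \in B -> holds_word t /\ holds_coword t.
Proof.
have dual_bounding := bounding_opposite (word_bounding (dual_closed closed_cs)).
move=> AB t tB; split.
  exact: bounding_sound (word_bounding closed_cs) AB (Pos t) tB.
exact: bounding_sound dual_bounding AB (Pos t) tB.
Qed.

Lemma derivation_generated B : derivation s (embed A) B ->
  {in B, forall u, generated_term (body u)}.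
Proof.
elim=> {B} [|B new AB gen_B r u]; first exact: generated_embed.
rewrite mem_cat => /orP[|/gen_B //].
by apply: rule_generated r u => //; apply: derivation_words AB.
Qed.

Local Notation d := (concept_size_bound (abox_size A)).
Local Notation words := (path_shapes (2 * d)).
Local Notation new_concepts := (generated_list cs (abox_size A)).

Lemma csize_new_concepts : {in new_concepts, forall C, csize C <= d}.
Proof. exact: csize_generated_list (@size_branch_abox _ _ _ A) (@csize_abox _ _ _ A). Qed.

Lemma mem_new_concepts C : generated cs C -> C \in new_concepts.
Proof. exact: mem_generated_list (@size_branch_abox _ _ _ A) C. Qed.

Definition path_listed : term CN (oname CN ON) (fname CN FN) -> Prop :=
  term_over (fun b => obj_path b \in words) (fun y => feat_path y \in words) (fun=> True).

Lemma modal_free_path_listed t : modal_free t -> path_listed t.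
Proof.
by apply: term_over_impl => // [b ->|y ->]; apply: mem_path_shapes.
Qed.

Lemma derivation_path_listed B t :
  derivation s (embed A) B -> Pos t \in B -> path_listed t.
Proof.
move=> AB tB; have gen_t := derivation_generated AB tB.
have depth_cs : bounding (L := depth_chain) (- Z.of_nat d)%Z (Z.of_nat d) (fun=> 0%Z) cs.
  by apply: depth_bounding => [|C /csize_abox]; rewrite /concept_size_bound; lia.
have size_gen C : generated cs C -> csize C <= d.
  by move=> /mem_new_concepts/csize_new_concepts.
have shape_t := shape_path_bounds (bounding_sound (shape_bounding cs) AB tB) gen_t.
have depth_t := depth_path_bounds size_gen (bounding_sound depth_cs AB tB) gen_t.
by apply: term_over_impl2 shape_t depth_t => *; first [exact: mem_path_shapes|by []].
Qed.

Definition obj_universe : seq (oname CN ON) :=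
  obj_list (obj_names A) new_concepts words.
Definition feat_universe : seq (fname CN FN) :=
  feat_list (feat_names A) new_concepts words.
Definition universe : tabox CN ON FN :=
  assertion_list obj_universe feat_universe new_concepts.

Lemma derivation_universe B : derivation s (embed A) B -> {subset B <= universe}.
Proof.
move=> AB u uB; apply/mem_assertion_list.
have path_u : path_listed (body u).
  case: u uB => t tB; first exact: derivation_path_listed AB tB.
  exact/modal_free_path_listed/(bounding_sound (shape_bounding cs) AB tB).
apply: term_over_impl2 (derivation_generated AB uB) path_u
  => [b|y|C /mem_new_concepts //].
  exact: mem_obj_list mem_new_concepts.
exact: mem_feat_list mem_new_concepts.
Qed.

Lemma tsize_universe :
  {in universe, forall u, tsize u <= assertion_size_bound (abox_size A)}.
Proof.
have osize_le b : b \in obj_universe -> osize b <= 2 * (2 * d).+1 + d.+1.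
  by apply: osize_obj_list csize_new_concepts b => w; apply: size_path_shape.
have fsize_le y : y \in feat_universe -> fsize y <= 2 * (2 * d).+1 + d.+1.
  by apply: fsize_feat_list csize_new_concepts y => w; apply: size_path_shape.
move=> u /mem_assertion_list; rewrite /tsize /assertion_size_bound.
case: (body u) => [b y|y b|b y|b C|y C] [].
- by move=> /osize_le ? /fsize_le ?; lia.
- by move=> /osize_le ? /fsize_le ?; lia.
- by move=> /osize_le ? /fsize_le ?; lia.
- by move=> /osize_le ? /csize_new_concepts ?; lia.
- by move=> /fsize_le ? /csize_new_concepts ?; lia.
Qed.

End Universe.

Definition concept_bound (n : nat) : nat := n + 2 * (n.+1 * (n * n)) * n.
Definition path_bound (n : nat) : nat :=
  2 * (2 * concept_size_bound n).+1 * ((2 * concept_size_bound n).+1 * 3).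
Definition name_bound (n : nat) : nat := (n + concept_bound n) * path_bound n.
Definition universe_bound (n : nat) : nat :=
  2 * (3 * (name_bound n * name_bound n) + name_bound n * concept_bound n
       + name_bound n * concept_bound n).

Lemma size_flatten_le1 (T U : Type) (f : T -> seq U) (r : seq T) :
  (forall x, size (f x) <= 1) -> size (flatten (map f r)) <= size r.
Proof. by move=> f_le1; elim: r => //= x r IHr; rewrite size_cat -add1n leq_add. Qed.

Section UniverseSize.
Variables (CN ON FN : eqType) (A : abox CN ON FN).
Local Notation n := (abox_size A).

Lemma size_abox : size A <= n.
Proof. by have := size_asize (embed A); rewrite size_map. Qed.

Lemma size_obj_names : size (obj_names A) <= n.
Proof.
by apply: leq_trans size_abox; apply: size_flatten_le1 => u; case: (body u).
Qed.

Lemma size_feat_names : size (feat_names A) <= n.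
Proof.
by apply: leq_trans size_abox; apply: size_flatten_le1 => u; case: (body u).
Qed.

Lemma size_new_concepts : size (generated_list (concepts A) n) <= concept_bound n.
Proof.
have size_cs : size (concepts A) <= n by rewrite -concepts_embed; apply: size_concepts.
rewrite size_generated_list leq_add // leq_mul // leq_mul2l leq_mul2l /=.
apply: leq_trans (size_branch_words (@csize_abox _ _ _ A)) _.
by rewrite leq_mul2r size_cs orbT.
Qed.

Lemma size_obj_universe : size (obj_universe A) <= name_bound n.
Proof.
rewrite size_obj_list size_path_shapes leq_mul // leq_add //.
  exact: size_obj_names.
exact: size_new_concepts.
Qed.

Lemma size_feat_universe : size (feat_universe A) <= name_bound n.
Proof.
rewrite size_feat_list size_path_shapes leq_mul // leq_add //.
  exact: size_feat_names.
exact: size_new_concepts.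
Qed.

Lemma size_universe : size (universe A) <= universe_bound n.
Proof.
rewrite size_assertion_list leq_mul2l /= !leq_add ?leq_mul2l ?leq_mul //=;
  by rewrite ?size_obj_universe ?size_feat_universe ?size_new_concepts.
Qed.

End UniverseSize.

(** * The running time *)

Definition within (T : Type) (time len : nat) (m : timed (seq T)) : Prop :=
  m.2 <= time /\ size m.1 <= len.

Lemma search_has_time (T : eqType) (p : T -> timed bool) r l k :
  size r <= l -> {in r, forall x, (p x).2 <= k} -> (search_has p r).2 <= l * k.+1.
Proof.
move=> r_le p_le; apply: (@leq_trans (size r * k.+1)); last first.
  by rewrite leq_mul2r r_le orbT.
elim: r p_le {r_le} => //= x r IHr /forall_cons[+ /IHr].
by rewrite mulSn; case: (p x) => -[] m /=; lia.
Qed.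

Lemma search_mem_time (T : eqType) (sz : T -> nat) x r l k m :
  size r <= l -> sz x <= m -> {in r, forall y, sz y <= k} ->
  (search_mem sz x r).2 <= l * (m + k).+1.
Proof.
by move=> r_le x_le sz_le; apply: search_has_time => // y /sz_le y_le; apply: leq_add.
Qed.

Lemma within_collect (T : eqType) (U : Type) (f : T -> timed (seq U)) r l k m :
  size r <= l -> {in r, forall x, within k m (f x)} ->
  within (l * (k + m).+1) (l * m) (collect f r).
Proof.
move=> r_le f_le.
suff [time_le size_le] : within (size r * (k + m).+1) (size r * m) (collect f r).
  by split; [apply: leq_trans time_le _|apply: leq_trans size_le _];
    rewrite leq_mul2r r_le orbT.
elim: r f_le {r_le} => //= x r IHr /forall_cons[[? ?] /IHr[? ?]].
by split; rewrite /= ?size_cat !mulSn; lia.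
Qed.

Section Instances.
Variables (CN ON FN : eqType) (s : separation ON FN).
Implicit Types (b : oname CN ON) (y : fname CN FN) (new : tabox CN ON FN).
Local Notation assert := (assertion CN (oname CN ON) (fname CN FN)).
Local Notation taboxes := (seq (tabox CN ON FN)).
Implicit Types (t u : assert) (m : timed taboxes).

Lemma within_when (ok : timed bool) m j k n : within j n m -> ok.2 + j <= k ->
  within k n (bind ok (fun v : bool => if v then m else ret [::])).
Proof. by rewrite /within; case: ok => -[] i /=; lia. Qed.

Lemma within_guard ok new k : ok.2 + asize new <= k -> within k 1 (guard ok new).
Proof. exact: (@within_when ok (emit new) (asize new)). Qed.

Lemma within_both m1 m2 k1 k2 n1 n2 k n :
  within k1 n1 m1 -> within k2 n2 m2 -> k1 + k2 + n1 < k -> n1 + n2 <= n ->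
  within k n (both m1 m2).
Proof. by rewrite /within /= size_cat; lia. Qed.

Lemma osize_odia b : osize (odia b) = (osize b).+1.
Proof. by case: b. Qed.

Lemma fsize_fbox y : fsize (fbox y) = (fsize y).+1.
Proof. by case: y. Qed.

Lemma within_obj_instances b y :
  within (2 * (osize b + fsize y) + 10) 2 (obj_instances b y).
Proof.
apply: (@within_both _ _ (osize b + fsize y + 2) (osize b + fsize y + 2) 1 1);
  [..|by lia|by []].
- case E: (odia_inv b) => [b1|]; last by [].
  split=> //; move/odia_invP: E => ->.
  by rewrite /= /asize /tsize /= osize_odia; lia.
- case: b => [a|C|b1|b1]; try by [];
  by split=> //; rewrite /= /asize /tsize /=; lia.
Qed.

Lemma within_feat_instances b y :
  within (2 * (osize b + fsize y) + 10) 2 (feat_instances b y).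
Proof.
apply: (@within_both _ _ (osize b + fsize y + 2) (osize b + fsize y + 2) 1 1);
  [..|by lia|by []].
- case E: (fbox_inv y) => [y1|]; last by [].
  split=> //; move/fbox_invP: E => ->.
  by rewrite /= /asize /tsize /= fsize_fbox; lia.
- case: y => [x|C|y1|y1]; try by [];
  by split=> //; rewrite /= /asize /tsize /=; lia.
Qed.

Lemma within_instances1 t : within (10 * tsize t + 30) 4 (instances1 s t).
Proof.
case: t => -[b y|y b|b y|b C|y C]; rewrite /instances1; try by [].
- apply: (@within_both _ _ (2 * (osize b + fsize y) + 6)
            (2 * (osize b + fsize y) + 6) 1 1); [..|by rewrite /tsize /=; lia|by []].
  + by split=> //; rewrite /= /asize /tsize /= fsize_fbox; lia.
  + case: s => [b0|y0]; last by [].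
    by apply: within_guard; rewrite /= /asize /tsize /=; lia.
- apply: (@within_both _ _ (2 * (osize b + fsize y) + 6)
            (2 * (osize b + fsize y) + 6) 1 1); [..|by rewrite /tsize /=; lia|by []].
  + by split=> //; rewrite /= /asize /tsize /= osize_odia; lia.
  + case: s => [b0|y0]; first by [].
    by apply: within_guard; rewrite /= /asize /tsize /=; lia.
- apply: within_both (within_obj_instances b y) (within_feat_instances b y) _ _ => //.
  by rewrite /tsize /=; lia.
- by case: C => *; rewrite /within /= /asize /tsize /=; lia.
- by case: C => *; rewrite /within /= /asize /tsize /=; lia.
- by rewrite /within /= /asize /tsize /=; lia.
- by rewrite /within /= /asize /tsize /=; lia.
Qed.

Section PairInstances.
Variables (cs : seq (concept CN)) (k z : nat).
Hypothesis size_cs : size cs <= k.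
Hypothesis csize_cs : {in cs, forall C, csize C <= z}.

Lemma within_guard_mem C u : csize C <= 2 * z + 1 -> tsize u <= 3 * z + 3 ->
  within (k * (3 * z + 2) + (3 * z + 3)) 1 (guard (search_mem (@csize CN) C cs) [:: u]).
Proof.
move=> C_le u_le; apply: within_guard; apply: leq_add; last by rewrite /asize /= addn0.
by have := search_mem_time size_cs C_le csize_cs; rewrite (_ : _.+1 = 3 * z + 2); lia.
Qed.

Lemma within_instances2_obj b b' C D :
  tsize (Pos (OIn b C) : assert) <= z ->
  tsize (Pos (OIn b' D) : assert) <= z ->
  within (5 * z + 3 + k * (3 * z + 2)) 1
    (instances2 cs (Pos (OIn b C)) (Pos (OIn b' D)) : timed taboxes).
Proof.
rewrite /tsize /= => C_le D_le.
apply: within_when (within_guard_mem (C := Meet C D) _ _) _; rewrite /tsize /=; lia.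
Qed.

Lemma within_instances2_feat y y' C D :
  tsize (Pos (FIn y C) : assert) <= z ->
  tsize (Pos (FIn y' D) : assert) <= z ->
  within (5 * z + 3 + k * (3 * z + 2)) 1
    (instances2 cs (Pos (FIn y C)) (Pos (FIn y' D)) : timed taboxes).
Proof.
rewrite /tsize /= => C_le D_le.
apply: within_when (within_guard_mem (C := Join C D) _ _) _; rewrite /tsize /=; lia.
Qed.

Lemma within_instances2_mixed b y C D :
  tsize (Pos (OIn b C) : assert) <= z ->
  tsize (Pos (FIn y D) : assert) <= z ->
  within (12 * z + 4) 3
    (instances2 cs (Pos (OIn b C)) (Pos (FIn y D)) : timed taboxes).
Proof.
rewrite /tsize /= => C_le D_le.
apply: (@within_both _ _ (4 * z) (8 * z + 2) 1 2); [..|by lia|by []].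
  by apply: within_guard; rewrite /= /asize /tsize /=; lia.
apply: (@within_both _ _ (4 * z) (4 * z) 1 1); [..|by lia|by []].
  by case: C C_le => //= C C_le; apply: within_guard; rewrite /= /asize /tsize /=; lia.
by case: D D_le => //= D D_le; apply: within_guard; rewrite /= /asize /tsize /=; lia.
Qed.

Lemma within_instances2 t u : tsize t <= z -> tsize u <= z ->
  within (12 * z + 4 + k * (3 * z + 2)) 3 (instances2 cs t u).
Proof.
case: t => [] // [] // b C C_le; case: u => [] // [] // y D D_le.
- by have := within_instances2_obj C_le D_le; rewrite /within; lia.
- by have := within_instances2_mixed C_le D_le; rewrite /within; lia.
- by have := within_instances2_feat C_le D_le; rewrite /within; lia.
Qed.

End PairInstances.
End Instances.

(* In the bounds below l bounds the number of assertions and z their size. *)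
Definition lookup_time (l z : nat) : nat := l * (z + z).+1.
Definition creation_time (l z : nat) : nat := l * z * (4 * z + 6 + 1).+1.
Definition single_time (l z : nat) : nat := l * (10 * z + 30 + 4).+1.
Definition pair_time (l z : nat) : nat :=
  l * (l * (12 * z + 4 + l * z * (3 * z + 2) + 3).+1 + l * 3).+1.
Definition instance_count (l z : nat) : nat := l * z + (l * 4 + l * (l * 3)).
Definition instances_time (l z : nat) : nat :=
  l * z + (creation_time l z + (single_time l z + pair_time l z + l * 4 + 1) + l * z + 1).
Definition round_bound (l z : nat) : nat :=
  (l * (lookup_time l z).+1 +
   (instances_time l z + instance_count l z * (2 * (lookup_time l z).+1 + 1).+1)).+1.

Section Round.
Variables (CN ON FN : eqType) (s : separation ON FN) (B : tabox CN ON FN) (l z : nat).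
Hypothesis size_B : size B <= l.
Hypothesis tsize_B : {in B, forall u, tsize u <= z}.

Lemma asize_le : asize B <= l * z.
Proof. by apply: leq_trans (asize_bound tsize_B) _; rewrite leq_mul2r size_B orbT. Qed.

Lemma csize_le : {in concepts B, forall C, csize C <= z}.
Proof. by move=> C /csize_concepts[u /tsize_B u_le C_le]; apply: leq_trans u_le. Qed.

Lemma within_creation_instances :
  within (creation_time l z) (l * z)
    (collect (fun C => emit [:: Pos (OIn (OCls C) C); Pos (FIn (FCls C) C)] :
                         timed (seq (tabox CN ON FN))) (concepts B)).
Proof.
rewrite -[l * z]muln1; apply: within_collect.
  exact: leq_trans (size_concepts B) asize_le.
move=> C /csize_le C_le.
by split=> //=; rewrite /asize /= /tsize /=; lia.
Qed.

Lemma within_instances : within (instances_time l z) (instance_count l z) (instances s B).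
Proof.
have single : within (single_time l z) (l * 4) (collect (instances1 s) B).
  apply: within_collect size_B _ => u /tsize_B u_le.
  by have := within_instances1 s u; rewrite /within; lia.
have double : within (pair_time l z) (l * (l * 3))
    (collect (fun t => collect (instances2 (concepts B) t) B) B).
  apply: within_collect size_B _ => t tB; apply: within_collect size_B _ => u uB.
  have size_cs := leq_trans (size_concepts B) asize_le.
  exact: (within_instances2 size_cs csize_le (tsize_B tB) (tsize_B uB)).
have [time_le size_le] := within_both within_creation_instances
  (within_both single double (leqnn _) (leqnn _)) (leqnn _) (leqnn _).
split; last exact: size_le.
by apply: leq_add asize_le _; apply: leq_trans time_le _; rewrite !addn1.
Qed.

Hypothesis rule_bounded : forall new, rule s B new ->
  size new <= 2 /\ {in new, forall u, tsize u <= z}.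

Lemma is_new_time new : rule s B new -> (is_new B new).2 <= 2 * (lookup_time l z).+1.
Proof.
move=> /rule_bounded[size_new tsize_new]; apply: search_has_time => // u /tsize_new u_le.
by rewrite /= addn0; apply: search_mem_time.
Qed.

Lemma find_clash_time : (find_clash B).2 <= l * (lookup_time l z).+1.
Proof.
apply: search_has_time => // -[u|u] uB //=; case: ifP => // _.
by apply: search_mem_time => //; have := tsize_B uB.
Qed.

Lemma round_time_bound : round_time s B <= round_bound l z.
Proof.
rewrite /round_time /round_bound ltnS leq_add ?find_clash_time //.
have [time_le size_le] := within_instances; rewrite leq_add //.
suff [] : within (instance_count l z * (2 * (lookup_time l z).+1 + 1).+1)
    (instance_count l z * 1) (collect (fun new => bind (is_new B new) (fun v : bool =>
      ret (if v then [:: new] else [::]))) (instances s B).1) by [].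
apply: within_collect size_le _ => new /mem_instances/is_new_time new_le.
by split; [rewrite /= addn0|rewrite /=; case: (is_new B new).1].
Qed.

End Round.

Definition poly_bounded (f : nat -> nat) : Prop :=
  exists c k, forall n, f n <= c * n ^ k + c.

Lemma leq_expn_add1 n i j : i <= j -> n ^ i <= n ^ j + 1.
Proof.
case: n => [|n] ij; first by case: i ij => [|i] _; rewrite ?expn0 ?leq_addl // exp0n.
by rewrite (leq_trans (leq_pexp2l _ ij)) // leq_addr.
Qed.

Lemma poly_bounded_const c : poly_bounded (fun=> c).
Proof. by exists c, 0 => n; rewrite leq_addl. Qed.

Lemma poly_bounded_id : poly_bounded id.
Proof. by exists 1, 1 => n; rewrite expn1 mul1n leq_addr. Qed.

Lemma poly_bounded_add f g :
  poly_bounded f -> poly_bounded g -> poly_bounded (fun n => f n + g n).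
Proof.
move=> [c [i f_le]] [d [j g_le]]; exists (2 * (c + d)), (i + j) => n.
have := leq_mul (leqnn c) (leq_expn_add1 n (leq_addr j i)).
have := leq_mul (leqnn d) (leq_expn_add1 n (leq_addl i j)).
by have := f_le n; have := g_le n; rewrite !mulnDr !mulnDl; lia.
Qed.

Lemma poly_bounded_mul f g :
  poly_bounded f -> poly_bounded g -> poly_bounded (fun n => f n * g n).
Proof.
move=> [c [i f_le]] [d [j g_le]]; exists (4 * (c * d)), (i + j) => n.
apply: leq_trans (leq_mul (f_le n) (g_le n)) _.
have expand : (c * n ^ i + c) * (d * n ^ j + d) =
    c * d * (n ^ (i + j) + n ^ i + n ^ j + 1) by rewrite expnD; lia.
rewrite expand (_ : _ + 4 * (c * d) = c * d * (4 * n ^ (i + j) + 4)); last by lia.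
have := leq_expn_add1 n (leq_addr j i); have := leq_expn_add1 n (leq_addl i j).
by move=> ? ?; apply: leq_mul => //; lia.
Qed.

Lemma poly_bounded_succ f : poly_bounded f -> poly_bounded (fun n => (f n).+1).
Proof.
move=> /poly_bounded_add/(_ (poly_bounded_const 1))[c [k f_le]].
by exists c, k => n; rewrite -addn1.
Qed.

Definition input_round_bound (n : nat) : nat :=
  round_bound (n + 2 * universe_bound n) (assertion_size_bound n).

Definition time_bound (n : nat) : nat := (universe_bound n).+1 * input_round_bound n.

Lemma poly_bounded_universe : poly_bounded universe_bound.
Proof.
rewrite /universe_bound /name_bound /path_bound /concept_bound /concept_size_bound.
by repeat first [apply: poly_bounded_const|apply: poly_bounded_id
  |apply: poly_bounded_succ|apply: poly_bounded_add|apply: poly_bounded_mul].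
Qed.

Lemma poly_bounded_time : poly_bounded time_bound.
Proof.
rewrite /time_bound /input_round_bound /round_bound /instances_time /instance_count.
rewrite /creation_time /single_time /pair_time /lookup_time.
rewrite /assertion_size_bound /concept_size_bound.
by repeat first [apply: poly_bounded_universe|apply: poly_bounded_const
  |apply: poly_bounded_id|apply: poly_bounded_succ|apply: poly_bounded_add
  |apply: poly_bounded_mul].
Qed.

Lemma rule_size (CN ON FN : eqType) (s : separation ON FN) (B new : tabox CN ON FN) :
  rule s B new -> size new <= 2.
Proof. by case. Qed.

Lemma size_undup_cat_new (T : eqType) (new B : seq T) :
  has [pred u | u \notin B] new -> size (undup B) < size (undup (new ++ B)).
Proof.
case/hasP=> u new_u /= uB; have uniq_u : uniq (u :: undup B).
  by rewrite /= mem_undup uB undup_uniq.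
apply: (uniq_leq_size uniq_u) => v; rewrite inE !mem_undup mem_cat.
by case/predU1P=> [->|->]; rewrite ?new_u ?orbT.
Qed.

Section Decision.
Variables (CN ON FN : eqType) (s : separation ON FN) (A : abox CN ON FN).
Local Notation n := (abox_size A).

Lemma reaches_round_time B t l : reaches s (embed A) B t -> size B <= l ->
  round_time s B <= round_bound l (assertion_size_bound n).
Proof.
move=> /reaches_derivation AB size_B; apply: round_time_bound size_B _ _.
  by move=> u /(derivation_universe AB)/tsize_universe.
move=> new r; split=> [|u new_u]; first exact: rule_size r.
apply/(tsize_universe (A := A))/(derivation_universe (derivation_rule AB r)).
by rewrite mem_cat new_u.
Qed.

Lemma size_undup_reaches B t :
  reaches s (embed A) B t -> size (undup B) <= universe_bound n.
Proof.
move=> /reaches_derivation/derivation_universe AB; apply: leq_trans (size_universe A).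
by apply: uniq_leq_size (undup_uniq B) _ => u; rewrite mem_undup => /AB.
Qed.

Lemma reaches_rounds B t : reaches s (embed A) B t ->
  exists r, [/\ t <= r * input_round_bound n, size B <= n + 2 * r & r <= size (undup B)].
Proof.
elim=> {B t} [|B t new AB [r [t_le size_le r_le]] _ [rule_new new_B]].
  by exists 0; split=> //; rewrite muln0 addn0; apply: size_asize.
have undup_le := size_undup_reaches AB.
exists r.+1; split.
- by rewrite mulSn addnC leq_add // (reaches_round_time AB) //; lia.
- by rewrite size_cat; have := rule_size rule_new; lia.
- exact: leq_ltn_trans r_le (size_undup_cat_new new_B).
Qed.

Lemma reaches_time B t : reaches s (embed A) B t -> t + round_time s B <= time_bound n.
Proof.
move=> AB; have [r [t_le size_le r_le]] := reaches_rounds AB.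
have undup_le := size_undup_reaches AB.
rewrite /time_bound mulSn addnC leq_add //.
  by apply: (reaches_round_time AB); lia.
by apply: leq_trans t_le _; rewrite leq_mul2r (leq_trans r_le undup_le) orbT.
Qed.

Lemma reaches_halted : exists B t, reaches s (embed A) B t /\ halted s B.
Proof.
suff halts k B t : reaches s (embed A) B t -> time_bound n - t <= k ->
    exists B t, reaches s (embed A) B t /\ halted s B.
  exact: halts (reaches_start s (embed A)) (leqnn _).
elim: k B t => [|k IHk] B t AB time_left.
  by have := reaches_time AB; rewrite /round_time; lia.
have [halted_B|running] := pselect (halted s B); first by exists B, t.
have [clash_B|noclash] := pselect (clash B); first by case: running; left.
have [new new_B] : exists new, applicable s B new.
  by apply/not_existsP => stuck; apply: running; right.
apply: IHk (reaches_round AB noclash new_B) _.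
by have := reaches_time AB; rewrite /round_time; lia.
Qed.

Lemma halted_clash_iff B t : reaches s (embed A) B t -> halted s B ->
  clash B <-> ~ consistent A s.
Proof.
move=> /reaches_derivation AB halted_B; split; first exact: clash_inconsistent AB.
case: halted_B => // stuck incons; have [//|noclash] := pselect (clash B).
by case: incons; apply: stuck_consistent AB noclash stuck.
Qed.

End Decision.

Theorem theorem3 (CN ON FN : eqType) :
  exists c k : nat,
    (forall (A : abox CN ON FN) (b : ON), obj_occurs b A ->
       decides_within (SA b) A (c * abox_size A ^ k + c)) /\
    (forall (A : abox CN ON FN) (y : FN), feat_occurs y A ->
       decides_within (SX y) A (c * abox_size A ^ k + c)).
Proof.
have [c [k time_le]] := poly_bounded_time; exists c, k.
have decides (A : abox CN ON FN) s : decides_within s A (c * abox_size A ^ k + c).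
  split; [|exact: reaches_halted|exact: halted_clash_iff].
  by move=> B t /reaches_time AB; apply: leq_trans AB (time_le _).
by split=> A ? _; apply: decides.
Qed.
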